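(* Consider the Basic Independence Model and let $0<\alpha<\lambda<1$. (1) Let $\hat n_0=\hat n_0((\hat F_n(t))_{t\ge\lambda})>0$ be an estimator that is a strictly positive measurable function of $(\hat F_n(t))_{t\ge\lambda}$, and consider the adaptive step down test with critical values $\hat\alpha_{i:n}=\left(\frac{i}{\hat n_0}\alpha\right)\wedge\lambda$, $i=1,\dots,n$. Then $$FDR=E\left(\frac{V_{SD}}{R_{SD}\vee1}\right)\le\frac{\alpha}{\lambda}E\left(\frac{V(\lambda)}{\hat n_0}\right).$$ (2) Moreover, for each of the following estimators $\hat n_0$ one has $E\left(\frac{V(\lambda)}{\hat n_0}\right)\le\lambda$, and the adaptive step down test with critical values $\hat\alpha_{i:n}=\left(\frac{i}{\hat n_0}\alpha\right)\wedge\lambda$ has $FDR\le\alpha$: (i) the generalized Storey estimator $\hat n_0=\hat n_0(\lambda_1,\gamma_1)$ with $\lambda\le\lambda_1<\gamma_1\le1$; for it also $E\left(\frac{V(\lambda)}{\hat n_0(\lambda_1,\gamma_1)}\,\big|\,(\hat F_n(t))_{t\ge\gamma_1}\right)\le\lambda$; (ii) $\hat n_0=\sum_{i=1}^k\beta_i\hat n_{0,i}$, where $\beta_1,\dots,\beta_k$ are fixed positive weights with $\sum_{i=1}^k\beta_i=1$ and each $\hat n_{0,i}$ is a strictly positive measurable function of $(\hat F_n(t))_{t\ge\lambda}$ with $E\left(\frac{V(\lambda)}{\hat n_{0,i}}\right)\le\lambda$; (iii) $\hat n_0=\sum_{i=1}^k\hat\beta_i\widetilde n_0(\gamma_i)$,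 where $\lambda<\gamma_1\le\dots\le\gamma_k\le1$, $\mathcal F_{\gamma_i}=\sigma((\hat F_n(t))_{t\ge\gamma_i})$, the weights $\hat\beta_i\ge0$ are $\mathcal F_{\gamma_i}$-measurable with $\sum_{i=1}^k\hat\beta_i=1$, and each $\widetilde n_0(\gamma_i)$ is a strictly positive measurable function of $(\hat F_n(t))_{t\ge\lambda}$ with $E\left(\frac{V(\lambda)}{\widetilde n_0(\gamma_i)}\,\big|\,\mathcal F_{\gamma_i}\right)\le\lambda$ (this includes the generalized Storey estimators $\hat n_0(\lambda_i,\gamma_i)$ with $\lambda\le\lambda_i<\gamma_i$).
   Context: Basic Independence (BI) Model: $n\ge 1$ null hypotheses $\mathcal H_1,\dots,\mathcal H_n$; $(H_i,\xi_i)_{i\le n}$ is an arbitrary random vector with values in $(\{0,1\}\times[0,1])^n$; $U_1,\dots,U_n$ are independent, uniformly distributed on $(0,1)$, and independent of $(H_i,\xi_i)_{i\le n}$. $\mathcal H_i$ is true if $H_i=0$ and false if $H_i=1$. The $p$-values are $p_i=(1-H_i)U_i+H_i\xi_i$. Put $N_0=\sum_{i=1}^n(1-H_i)$ and assume $E(N_0)>0$. Let $\hat F_n(t)=\frac1n\sum_{i=1}^n 1\{p_i\le t\}$, $t\in[0,1]$, and let $p_{1:n}\le\dots\le p_{n:n}$ be the order statistics of the $p$-values. Notation: $a\wedge b=\min(a,b)$, $a\vee b=\max(a,b)$. For $t\in[0,1]$: $V(t)=\sum_{i=1}^n 1\{p_i\le t,H_i=0\}$. Generalized Storey estimator, for $\lambda\le\lambda_1<\gamma_1\le1$: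 $$\hat n_0(\lambda_1,\gamma_1)=n\,\frac{\hat F_n(\gamma_1)-\hat F_n(\lambda_1)+\frac1n}{\gamma_1-\lambda_1}.$$ Adaptive step down (SD) test with data dependent critical values $0=\hat\alpha_{0:n}<\hat\alpha_{1:n}\le\dots\le\hat\alpha_{n:n}<1$: with $R_{SD}=\max\{i: p_{j:n}\le\hat\alpha_{j:n}\text{ for all }j\le i\}$ ($\max\emptyset=0$), it rejects all null hypotheses whose $p$-value is $\le\hat\alpha_{R_{SD}:n}$; $R_{SD}$ is the number of rejections. $V_{SD}=\sum_{i=1}^n 1\{p_i\le\hat\alpha_{R_{SD}:n},H_i=0\}$ is the number of false rejections, and the FDR of the SD test is $E\left(\frac{V_{SD}}{R_{SD}\vee1}\right)$. Inequalities between conditional expectations and constants are understood almost surely. *)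

(* Defs.v *)
From HB Require Import structures.
From mathcomp Require Export all_boot all_order all_algebra.
From mathcomp Require Export all_classical all_reals all_analysis.
From mathcomp Require Export measurable_realfun.

Set Implicit Arguments.
Unset Strict Implicit.
Unset Printing Implicit Defensive.

Import Order.TTheory GRing.Theory Num.Theory.

Local Open Scope classical_set_scope.
Local Open Scope ring_scope.

(* Generators of sigma(X_i : i in D); the sigma-algebra is <<s gen D X >>. *)
Definition gen d' (T : Type) (T' : measurableType d') (I : Type)
    (D : set I) (X : I -> T -> T') : set (set T) :=
  \bigcup_(i in D) preimage_set_system setT (X i) measurable.

(* Measurability with respect to <<s G >>, on a type that need not carry a
   canonical measurable structure, or that carries a larger one. *)
Definition sigma_measurable d' (T : Type) (T' : sigmaRingType d')
    (G : set (set T)) (f : T -> T') : Prop :=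
  forall B, measurable B -> <<s G >> (f @^-1` B).

Section probability.
Context d (T : measurableType d) (R : realType) (P : probability T R).
Local Open Scope ereal_scope.

Definition indep_sigma (G1 G2 : set (set T)) : Prop :=
  forall A B, <<s G1 >> A -> <<s G2 >> B -> P (A `&` B) = P A * P B.

Definition mutually_indep n (X : 'I_n -> T -> R) : Prop :=
  forall (J : {set 'I_n}) (B : 'I_n -> set R),
    (forall i, measurable (B i)) ->
    P (\bigcap_(i in [set` J]) (X i @^-1` B i)) =
    \prod_(i in J) P (X i @^-1` B i).

(* Y is a version of E(X | <<s G >>) for a nonnegative X; neither X nor Y has
   to be integrable. *)
Definition is_cond_expectation (G : set (set T)) (X : T -> R)
    (Y : T -> \bar R) : Prop :=
  sigma_measurable G Y /\
  forall A, <<s G >> A -> \int[P]_(w in A) Y w = \int[P]_(w in A) (X w)%:E.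

(* E(X | <<s G >>) <= c almost surely. Versions agree almost surely, so one
   version satisfies the bound iff all of them do. *)
Definition cond_expectation_le (G : set (set T)) (X : T -> R) (c : R) : Prop :=
  exists2 Y, is_cond_expectation G X Y & {ae P, forall w, Y w <= c%:E}.

End probability.

(* The family F_n(t), lambda <= t <= 1, is encoded by functions R -> R carrying
   the sigma-algebra generated by the evaluations at the points of
   [lambda, 1], so that measurable functionals ignore all other values. *)
Definition evaluations (R : realType) (lambda : R) : set (set (R -> R)) :=
  gen `[lambda, 1] (fun (t : R) (f : R -> R) => f t).

Section testing.
Context d (T : measurableType d) (R : realType) (n : nat).

Section pvalues.
Variables (H : 'I_n -> T -> bool) (xi U : 'I_n -> T -> R).

Definition pvalue (i : 'I_n) (w : T) : R :=
  (1 - (H i w)%:R) * U i w + (H i w)%:R * xi i w.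

Definition N0 (w : T) : R := \sum_(i < n) (1 - (H i w)%:R).

End pvalues.

Section ecdf.
Variable p : 'I_n -> T -> R.

Definition ecdf (t : R) (w : T) : R := n%:R^-1 * \sum_(i < n) (p i w <= t)%R%:R.

(* p_{j:n}, for 1 <= j <= n *)
Definition order_stat (j : nat) (w : T) : R :=
  nth 0 (sort <=%R [seq p i w | i <- enum 'I_n]) j.-1.

Definition ecdf_gen (t0 : R) : set (set T) := gen `[t0, 1] ecdf.

Definition ecdf_estimator (lambda : R) (n0 : T -> R) : Prop :=
  (exists2 g : (R -> R) -> R, sigma_measurable (evaluations lambda) g &
     forall w, n0 w = g (fun t => ecdf t w)) /\
  (forall w, 0 < n0 w).

Definition storey (lambda1 gamma1 : R) (w : T) : R :=
  n%:R * ((ecdf gamma1 w - ecdf lambda1 w + n%:R^-1) / (gamma1 - lambda1)).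

(* The critical values are crit 1, ..., crit n, and crit 0 plays the role of
   alpha_{0:n} = 0. The index i = 0 always qualifies, hence max emptyset = 0. *)
Definition R_SD (crit : nat -> T -> R) (w : T) : nat :=
  \max_(i < n.+1 | [forall j : 'I_n.+1,
    (0 < j <= i)%N ==> (order_stat j w <= crit j w)]) i.

Variable H : 'I_n -> T -> bool.

Definition V (t : R) (w : T) : R :=
  \sum_(i < n) ((p i w <= t)%R && ~~ H i w)%:R.

Definition V_SD (crit : nat -> T -> R) (w : T) : R :=
  V (crit (R_SD crit w) w) w.

Definition FDR_SD (P : probability T R) (crit : nat -> T -> R) : \bar R :=
  'E_P[fun w => V_SD crit w / (maxn (R_SD crit w) 1)%:R].

End ecdf.

(* For i = 0 and lambda > 0 this is 0. *)
Definition adaptive_crit (alpha lambda : R) (n0 : T -> R)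
    (i : nat) (w : T) : R :=
  Num.min (i%:R / n0 w * alpha) lambda.

Record BI_model (P : probability T R) (H : 'I_n -> {mfun T >-> bool})
    (xi U : 'I_n -> {mfun T >-> R}) : Prop := {
  BI_n_gt0 : (0 < n)%N;
  BI_xi : forall i w, 0 <= xi i w <= 1;
  BI_U_unif : forall i (B : set R), measurable B ->
    distribution P (U i) B = uniform_prob (@ltr01 R) B;
  BI_U_indep : mutually_indep P U;
  BI_U_H_xi : indep_sigma P (gen setT U) (gen setT H `|` gen setT xi);
  BI_N0 : (0 < 'E_P[@N0 H])%E
}.

End testing.

(* Main.v *)
(* Fix a true null hypothesis i and let E be the event that p_i <= gamma. On E,
   the functions F_n(t), t >= gamma, depend only on H, xi and the U_j, j != i;
   conditionally on E they are therefore independent of U_i, which is uniform on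
   [0, gamma]. The sigma-algebra "trace" of the events that agree on E with an
   event determined by H, xi and the U_j, j != i, makes this precise, so no
   conditional distributions are needed.

   (1) If i is rejected, then R_SD is unchanged when p_i is replaced by 0, so
   the critical value that p_i is compared with is a function r * alpha / n0 (at
   most) of variables independent of U_i; integrating over U_i leaves at most
   alpha / (lambda n0) on E with gamma = lambda. Sum over i.

   (2)(i) Let M be the number of p-values in ]lambda1, gamma1]. On E, exchanging
   the event U_i <= lambda with lambda1 < U_i <= gamma1 turns 1 / (M + 1) into
   1 / M, up to the factor lambda / (gamma1 - lambda1), and the sum over i of
   the latter terms is at most 1.

   (2)(ii), (iii) x |-> 1 / x is convex. *)

Require Import Defs.
From HB Require Import structures.
From mathcomp Require Import all_boot all_order all_algebra.
From mathcomp Require Import all_classical all_reals all_analysis.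
From mathcomp Require Import ring.

Set Implicit Arguments.
Unset Strict Implicit.
Unset Printing Implicit Defensive.

Import Order.TTheory GRing.Theory Num.Theory.
Local Open Scope classical_set_scope.
Local Open Scope ring_scope.

(** * Independence of one p-value from the rest *)

Lemma sigma_gen_measurable d (T : measurableType d) (G : set (set T)) :
  G `<=` measurable -> <<s G >> `<=` measurable.
Proof.
by apply: smallest_sub; exact: sigma_algebra_measurable.
Qed.

(** Makes the library closure lemmas for measurable functions available for a generated
    sigma-algebra. *)
Lemma sigma_measurableE d' (T : pointedType) (T' : measurableType d')
    (G : set (set T)) (f : T -> T') :
  sigma_measurable G f <-> measurable_fun setT (f : g_sigma_algebraType G -> T').
Proof.
split=> [mf _ B mB|mf B mB]; first by rewrite setTI; exact: mf.
by rewrite -[X in <<s G >> X]setTI; exact: (mf measurableT).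
Qed.

Lemma gen_preimage d' (T : Type) (T' : measurableType d') (I : Type)
    (D : set I) (X : I -> T -> T') i B :
  D i -> measurable B -> gen D X (X i @^-1` B).
Proof. by move=> Di mB; exists i => //; exists B => //; rewrite setTI. Qed.

Lemma gen_sub d' (T : Type) (T' : measurableType d') (I : Type)
    (D : set I) (X : I -> T -> T') (S : set (set T)) :
  (forall i B, D i -> measurable B -> S (X i @^-1` B)) -> gen D X `<=` S.
Proof.
by move=> XS A [i Di [B mB <-]]; rewrite setTI; exact: XS.
Qed.

(** The sets whose preimage lies in [<<s G >>] form a sigma-algebra, so generators suffice. *)
Lemma sigma_preimage (T T' : Type) (f : T -> T') (G : set (set T))
    (G' : set (set T')) :
  (forall B, G' B -> <<s G >> (f @^-1` B)) ->
  forall B, <<s G' >> B -> <<s G >> (f @^-1` B).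
Proof.
move=> fG B G'B; rewrite -[X in <<s G >> X]setTI; move: B G'B.
apply: smallest_sub => [|B /fG]; last by rewrite /= /image_set_system /= setTI.
apply: sigma_algebra_image; exact: smallest_sigma_algebra.
Qed.

Section independence.
Context d (T : measurableType d) (R : realType) (P : probability T R).
Local Open Scope ereal_scope.

(** As functions of [A], both sides are finite measures: [P] restricted to [B], and [P] scaled by
    [P B]. They agree on a pi-system containing [setT], hence on the sigma-algebra it generates. *)
Lemma indep_sigma_setI_closed (G : set (set T)) (B : set T) :
  G `<=` measurable -> setI_closed G -> G setT -> measurable B ->
  (forall A, G A -> P (A `&` B) = P A * P B) ->
  forall A, <<s G >> A -> P (A `&` B) = P A * P B.
Proof.
move=> mG GI GT mB GB A GA.
have PB : P B \is a fin_num by exact: fin_num_measure.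
have r0 : (0 <= fine (P B))%R by exact: fine_ge0.
have rE C : mscale (NngNum r0) P C = P C * P B by rewrite /mscale/= fineK// muleC.
rewrite -rE -[LHS]/(mrestr P mB A).
apply: (@g_sigma_algebra_measure_unique _ R T G mG (fun=> setT) (fun=> GT)) => //.
- by rewrite bigcup_const//; exists 0%N.
- by move=> C /GB; rewrite -rE.
- by move=> _; rewrite /= /mrestr setTI ltey_eq fin_num_measure.
Qed.

End independence.

Section BI.
Context d (T : measurableType d) (R : realType) (P : probability T R) (n : nat).
Variables (H : 'I_n -> {mfun T >-> bool}) (xi U : 'I_n -> {mfun T >-> R}).

(** [H i] and [xi i] are included; only [U i] is left out. *)
Definition others (i : 'I_n) : set (set T) :=
  (gen setT H `|` gen setT xi) `|` gen [set j | j != i] U.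

Lemma others_measurable i : <<s others i >> `<=` measurable.
Proof.
apply: sigma_gen_measurable => A [[]|];
  by move: A; apply: gen_sub => j B _ mB; rewrite -[X in measurable X]setTI;
     exact: measurable_funP.
Qed.

Hypothesis BI : BI_model P H xi U.
Local Open Scope ereal_scope.

Let HX : set (set T) := gen setT H `|` gen setT xi.

Let box (B : 'I_n -> set R) :=
  \bigcap_(j in [set` [set: 'I_n]%SET]) (U j @^-1` B j).

(** A pi-system that generates [others i]; the condition [B i = setT] leaves [U i] unconstrained. *)
Let boxS (i : 'I_n) : set (set T) :=
  [set A | exists C B, [/\ <<s HX >> C, forall j, measurable (B j),
     B i = setT & A = C `&` box B]].

Let mHX : <<s HX >> `<=` measurable.
Proof.
apply: sigma_gen_measurable => A [];
  by move: A; apply: gen_sub => j B _ mB; rewrite -[X in measurable X]setTI;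
     exact: measurable_funP.
Qed.

Let box_gen B : (forall j, measurable (B j)) -> <<s gen setT U >> (box B).
Proof.
move=> mB; apply: (@fin_bigcap_measurable _ (g_sigma_algebraType (gen setT U))).
- exact: finite_finset.
- by move=> j _; apply: sub_sigma_algebra; exact: gen_preimage.
Qed.

Let P_box C B : <<s HX >> C -> (forall j, measurable (B j)) ->
  P (C `&` box B) = P C * \prod_(j in [set: 'I_n]%SET) P (U j @^-1` B j).
Proof.
move=> hC mB; rewrite setIC (BI_U_H_xi BI)//; last exact: box_gen.
by rewrite muleC (BI_U_indep BI).
Qed.

(** For [A] in [boxS i], the condition on [U i] fills the free coordinate of the box and [P_box]
    factors the probability. Uniqueness of measures extends this to the generated sigma-algebra. *)
Lemma indep_others i A B : <<s others i >> A -> measurable B ->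
  P (A `&` U i @^-1` B) = P A * P (U i @^-1` B).
Proof.
move=> oA mB.
have mU : measurable (U i @^-1` B).
  by rewrite -[X in measurable X]setTI; exact: measurable_funP.
apply: (@indep_sigma_setI_closed _ _ _ _ (boxS i)) => //.
- move=> _ [C [D [hC mD _ ->]]]; apply: measurableI; first exact: mHX.
  apply: (@sigma_gen_measurable _ _ (gen setT U)); last exact: box_gen.
  by apply: gen_sub => j E _ mE; rewrite -[X in measurable X]setTI;
     exact: measurable_funP.
- move=> _ _ [C [D [hC mD Di ->]]] [C' [D' [hC' mD' Di' ->]]].
  exists (C `&` C'), (fun j => D j `&` D' j); split.
  + exact: (@measurableI _ (g_sigma_algebraType HX)).
  + by move=> j; exact: measurableI.
  + by rewrite Di Di' setIT.
  + rewrite setIACA; congr (_ `&` _); rewrite /box.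
    by rewrite -bigcapI.
- exists setT, (fun=> setT); split => //.
  + exact: (@measurableT _ (g_sigma_algebraType HX)).
  + by rewrite setTI; apply/esym; rewrite -subTset => w _ j.
- move=> _ [C [D [hC mD Di ->]]].
  pose D' j := if j == i then B else D j.
  have mD' j : measurable (D' j) by rewrite /D'; case: ifP.
  have -> : C `&` box D `&` U i @^-1` B = C `&` box D'.
    rewrite -setIA; congr (_ `&` _); apply/seteqP; split=> w.
      move=> [bw Bw] j jT; rewrite /D' /preimage/=; case: ifPn => [/eqP ->//|_].
      exact: bw.
    move=> bw; split; last by have := bw i (finset.in_setT i); rewrite /D' eqxx.
    move=> j jT; have := bw j jT; rewrite /D' /preimage/=.
    by case: ifPn => [/eqP -> _|//]; rewrite Di.
  rewrite !P_box// -muleA; congr (_ * _).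
  rewrite (bigD1 i) ?finset.in_setT//= [in RHS](bigD1 i) ?finset.in_setT//=.
  rewrite Di preimage_setT.
  rewrite probability_setT mul1e {1}/D' eqxx muleC; congr (_ * _).
  by apply: eq_bigr => j /andP[_ /negbTE ji]; rewrite /D' ji.
(* It remains that every generator of [others i] lies in [boxS i]: those from [H] and [xi] with a
   trivial box, those from [U j] with a box constrained at [j] only. *)
move: A oA; apply: smallest_sub; first exact: smallest_sigma_algebra.
have boxT : box (fun=> setT) = setT by rewrite -subTset => w _ j.
move=> A [hA|].
  apply: sub_sigma_algebra; exists A, (fun=> setT); split => //.
    exact: sub_sigma_algebra.
  by rewrite boxT setIT.
move: A; apply: gen_sub => j D /= ji mD; apply: sub_sigma_algebra.
exists setT, (fun k => if k == j then D else setT); split.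
- exact: (@measurableT _ (g_sigma_algebraType HX)).
- by move=> k; case: ifP.
- by rewrite eq_sym (negbTE ji).
rewrite setTI; apply/seteqP; split=> w.
  by move=> Dw k _; rewrite /preimage/=; case: ifPn => // /eqP ->.
by move=> /(_ j (finset.in_setT j)); rewrite eqxx.
Qed.

End BI.

(** * Restriction of a measure to a sub-sigma-algebra *)

Section sub_sigma_algebra.
Context d (T : measurableType d) (R : realType).
Variables (P : {finite_measure set T -> \bar R}) (G : set (set T)).
Hypothesis mG : <<s G >> `<=` measurable.
Local Open Scope ereal_scope.

Local Notation TG := (g_sigma_algebraType G).

Lemma measurable_sub_sigma d' (T' : measurableType d') (D : set T) (f : T -> T') :
  <<s G >> D -> measurable_fun (D : set TG) (f : TG -> T') -> measurable_fun D f.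
Proof. by move=> GD mf mD B mB; apply: mG; exact: mf. Qed.

(** The inclusion is an argument because the measure structure attached below depends on it. *)
Definition sub_measure & <<s G >> `<=` (measurable : set (set T)) :=
  fun A : set TG => P A.

Local Notation sub_measureG := (sub_measure mG).

Let sub_measure0 : sub_measureG set0 = 0. Proof. exact: measure0. Qed.

Let sub_measure_ge0 A : 0 <= sub_measureG A. Proof. exact: measure_ge0. Qed.

Let sub_measure_sigma_additive : semi_sigma_additive sub_measureG.
Proof.
move=> F GF tF GUF; apply: measure_semi_sigma_additive => //; last exact: mG.
by move=> k; apply: mG; exact: GF.
Qed.

HB.instance Definition _ := isMeasure.Build _ _ _ sub_measureG
  sub_measure0 sub_measure_ge0 sub_measure_sigma_additive.

Let sub_measure_fin : fin_num_fun sub_measureG.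
Proof. by move=> A GA; apply: fin_num_measure; exact: mG. Qed.

HB.instance Definition _ := @Measure_isFinite.Build _ _ _ sub_measureG
  sub_measure_fin.

Lemma ge0_integral_sub_measure (D : set T) (f : T -> \bar R) :
  <<s G >> D -> measurable_fun (D : set TG) (f : TG -> \bar R) ->
  (forall x, D x -> 0 <= f x) ->
  \int[sub_measureG]_(x in (D : set TG)) (f : TG -> \bar R) x =
  \int[P]_(x in D) f x.
Proof.
move=> GD mf f0; have mid : measurable_fun setT (id : T -> TG).
  by move=> _ A GA; rewrite setTI; exact: mG.
rewrite [LHS](ge0_integral_pushforward mid P)//.
by move=> x; rewrite inE; exact: f0.
Qed.

End sub_sigma_algebra.

(** * Integrating out a variable that is independent on an event *)

Section indep_on.
Context d d2 (T : measurableType d) (T2 : measurableType d2) (R : realType).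
Variables (P : probability T R) (G : set (set T)) (E : set T) (X : T -> T2).
Variable nu : probability T2 R.
Hypotheses (mG : <<s G >> `<=` measurable) (GE : <<s G >> E).
Hypothesis mX : measurable_fun setT X.
Local Open Scope ereal_scope.
Hypothesis indep : forall A B, <<s G >> A -> measurable B ->
  P (A `&` E `&` X @^-1` B) = P (A `&` E) * nu B.

Local Notation TG := (g_sigma_algebraType G).

Let mE : measurable E. Proof. exact: mG. Qed.

Let phi (w : T) : TG * T2 := (w, X w).

Let mphi : measurable_fun setT phi.
Proof.
apply: measurable_fun_pair => // _ A GA.
by rewrite setTI; exact: mG.
Qed.

(** Under [P] restricted to [E], the pair [phi] has a product law, as [indep] shows on rectangles;
    Tonelli then integrates out the second coordinate. *)
Lemma integral_indep_on (f : TG * T2 -> \bar R) :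
  measurable_fun setT f -> (forall z, 0 <= f z) ->
  \int[P]_(w in E) f (w, X w) = \int[P]_(w in E) \int[nu]_x f (w, x).
Proof.
move=> mf f0.
pose PE : {finite_measure set T -> \bar R} := mrestr P mE.
pose m1 := sub_measure PE mG.
have joint (C : set (TG * T2)) : measurable C ->
    (m1 \x nu) C = pushforward PE phi C.
  apply: product_measure_unique => A B mA mB.
  rewrite /m1/= /sub_measure/= /pushforward /= /mrestr /= -indep//.
  by congr (P _); apply/seteqP; split=> w /= [[]].
have mEE : measurable ((E : set TG) `*` (setT : set T2)) by exact: measurableX.
have mF : measurable_fun setT (fubini_F nu f).
  exact: measurable_fun_fubini_tonelli_F.
transitivity (\int[PE]_(w in E) (f \o phi) w).
  by apply: eq_measure_integral => A mA AE; rewrite /= /mrestr setIidl.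
transitivity (\int[pushforward PE phi]_(z in E `*` setT) f z).
  rewrite ge0_integral_pushforward//; last exact: measurable_funTS.
  congr (integral _ _ _); apply/seteqP; by split=> w /=; [split|case].
transitivity (\int[m1 \x nu]_(z in E `*` setT) f z).
  by apply: eq_measure_integral => A mA _; exact/esym/joint.
rewrite integral_mkcond/= fubini_tonelli1//; last 2 first.
- by apply/(measurable_restrictT _ _).1 => //; exact: measurable_funTS.
- by move=> z; exact: erestrict_ge0.
transitivity (\int[m1]_(w in E) fubini_F nu f w).
  rewrite [RHS]integral_mkcond; apply: eq_integral => w _.
  rewrite /fubini_F !patchE; case: ifPn => wE.
    apply: eq_integral => u _; rewrite patchE ifT// inE/=; split=> //.
    by rewrite inE in wE.
  rewrite -[RHS](@integral0 _ _ _ nu setT).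
  apply: eq_integral => u _; rewrite patchE ifF//; apply/negbTE.
  by move: wE; rewrite !notin_setE/=; apply: contra_not => -[].
rewrite /m1 ge0_integral_sub_measure//; last 2 first.
- exact: measurable_funTS.
- by move=> w _; apply: integral_ge0.
by apply: eq_measure_integral => A mA AE; rewrite /= /mrestr setIidl.
Qed.

End indep_on.

(** * Uniform laws on nested intervals *)

Section uniform.
Context (R : realType).
Local Open Scope ereal_scope.

(** A uniform variable on [0, b] conditioned to be at most [c] is uniform on [0, c]: the densities
    satisfy 1 / b = (c / b) (1 / c). *)
Lemma uniform_prob_le (b c : R) (b0 : (0 < b)%R) (c0 : (0 < c)%R) (B : set R) :
  (c <= b)%R -> measurable B ->
  uniform_prob b0 (B `&` `]-oo, c]) = (c / b)%:E * uniform_prob c0 B.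
Proof.
move=> cb mB; rewrite /uniform_prob.
have mpdf : measurable_fun B (fun x => (uniform_pdf 0%R c x)%:E).
  apply: measurable_funTS; apply/measurable_EFinP.
  exact: measurable_uniform_pdf.
rewrite -(@ge0_integralZl _ _ R lebesgue_measure B mB
  (fun x => (uniform_pdf 0%R c x)%:E) mpdf)//; last 2 first.
- by move=> x _; rewrite lee_fin uniform_pdf_ge0.
- by rewrite lee_fin divr_ge0// ltW.
rewrite integral_mkcondr; apply: eq_integral => x _.
rewrite patchE /uniform_pdf !subr0 -EFinM mem_setE/= in_itv/=.
case: (leP x c) => xc; last first.
  by rewrite andbF mulr0.
rewrite (le_trans xc cb) !andbT; case: ifP => _; last by rewrite mulr0.
by rewrite mulrAC divff ?mul1r// gt_eqF.
Qed.

Lemma uniform_prob_itv (b c : R) (b0 : (0 < b)%R) :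
  (0 < c)%R -> (c <= b)%R -> uniform_prob b0 `]-oo, c] = (c / b)%:E.
Proof.
move=> c0 cb; rewrite -[X in uniform_prob _ X]setTI uniform_prob_le//.
by rewrite (@probability_setT _ _ _ (uniform_prob c0)) mule1.
Qed.

End uniform.

Lemma measurable_natr_bool d (T : measurableType d) (R : realType)
    (D : set T) (b : T -> bool) :
  measurable_fun D b -> measurable_fun D (fun x => (b x)%:R : R).
Proof.
move=> mb.
rewrite (_ : (fun _ => _) = fun x => if b x then 1 else 0); last first.
  by apply/funext => x; case: (b x).
by move=> mD; apply: measurable_fun_if.
Qed.

(** * Measurability of the p-values *)

Section pvalue_measurability.
Context d (T : measurableType d) (R : realType) (n : nat).
Variables (H : 'I_n -> {mfun T >-> bool}) (xi U : 'I_n -> {mfun T >-> R}).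

Lemma measurable_pvalue k : measurable_fun setT (pvalue H xi U k).
Proof.
apply: measurable_funD; apply: measurable_funM => //.
  by apply: measurable_funB => //; exact: measurable_natr_bool.
exact: measurable_natr_bool.
Qed.

Lemma measurable_ecdf t : measurable_fun setT (ecdf (pvalue H xi U) t).
Proof.
apply: measurable_funM => //; apply: measurable_sum => k.
apply: measurable_natr_bool; apply: measurable_fun_ler => //.
exact: measurable_pvalue.
Qed.

Lemma ecdf_gen_measurable t : <<s ecdf_gen (pvalue H xi U) t >> `<=` measurable.
Proof.
apply: sigma_gen_measurable; apply: gen_sub => s B _ mB.
by rewrite -[X in measurable X]setTI; exact: measurable_ecdf.
Qed.

Lemma measurable_pvalue_others i k : k != i ->
  sigma_measurable (others H xi U i) (pvalue H xi U k).
Proof.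
move=> ki; apply/sigma_measurableE.
have mH : measurable_fun setT (H k : g_sigma_algebraType (others H xi U i) -> bool).
  by apply/sigma_measurableE => B mB; apply: sub_sigma_algebra; left; left;
     exact: gen_preimage.
have mxi : measurable_fun setT (xi k : g_sigma_algebraType (others H xi U i) -> R).
  by apply/sigma_measurableE => B mB; apply: sub_sigma_algebra; left; right;
     exact: gen_preimage.
have mU : measurable_fun setT (U k : g_sigma_algebraType (others H xi U i) -> R).
  by apply/sigma_measurableE => B mB; apply: sub_sigma_algebra; right;
     exact: gen_preimage.
apply: measurable_funD; apply: measurable_funM => //.
  by apply: measurable_funB => //; exact: measurable_natr_bool.
exact: measurable_natr_bool.
Qed.

End pvalue_measurability.

(** * Conditional independence on the event that a true null has a small p-value *)

Section trace.
Context d (T : measurableType d) (R : realType) (P : probability T R) (n : nat).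
Variables (H : 'I_n -> {mfun T >-> bool}) (xi U : 'I_n -> {mfun T >-> R}).
Variables (i : 'I_n) (gamma : R).

(** Stated with [U i], which is the p-value of a true hypothesis [i]. *)
Definition null : set T := [set w | ~~ H i w && (U i w <= gamma)].

Lemma measurable_null : measurable null.
Proof.
rewrite (_ : null = H i @^-1` [set false] `&` U i @^-1` `]-oo, gamma]).
  by apply: measurableI; rewrite -[X in measurable X]setTI; exact: measurable_funP.
apply/seteqP; split=> w; rewrite /null/= in_itv/=.
  by move=> /andP[/negbTE].
by move=> [->].
Qed.

(** Measurability of [A] is a separate requirement, since the second condition says nothing about
    [A] off [null]. *)
Definition trace : set (set T) :=
  [set A | measurable A /\
     exists2 A', <<s others H xi U i >> A' & A `&` null = A' `&` null].

Local Notation Toth := (g_sigma_algebraType (others H xi U i)).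

Lemma sigma_algebra_trace : sigma_algebra setT trace.
Proof.
split.
- split; first exact: measurable0.
  by exists set0 => //; exact: sigma_algebra0.
- move=> A [mA [A' oA' AA']]; split; first exact: measurableD.
  exists (~` A'); first exact: (@measurableC _ Toth).
  rewrite setTD; apply/seteqP; split=> w [nA Ew]; split=> // Aw; apply: nA.
    by have [] : (A `&` null) w by rewrite AA'.
  by have [] : (A' `&` null) w by rewrite -AA'.
- move=> F mF; split; first by apply: bigcupT_measurable => k; case: (mF k).
  have /choice[F' F'P] : forall k, exists A', <<s others H xi U i >> A' /\
      F k `&` null = A' `&` null.
    by move=> k; have [_ [A' oA' ?]] := mF k; exists A'.
  exists (\bigcup_k F' k).
    by apply: (@bigcupT_measurable _ Toth) => k; case: (F'P k).
  by rewrite !setI_bigcupl; apply: eq_bigcupr => k _; case: (F'P k).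
Qed.

Lemma sigma_traceE : <<s trace >> = trace.
Proof. exact: sigma_algebra_id sigma_algebra_trace. Qed.

Lemma trace_measurable : <<s trace >> `<=` measurable.
Proof. by rewrite sigma_traceE => A []. Qed.

Lemma others_trace : <<s others H xi U i >> `<=` <<s trace >>.
Proof.
rewrite sigma_traceE => A oA; split; first exact: others_measurable oA.
by exists A.
Qed.

Lemma trace_null : <<s trace >> null.
Proof.
rewrite sigma_traceE; split; first exact: measurable_null.
exists setT; last by rewrite setTI setIid.
exact: (@measurableT _ Toth).
Qed.

Lemma eq_on_null_trace d' (T' : measurableType d') (f g : T -> T') :
  measurable_fun setT f -> sigma_measurable (others H xi U i) g ->
  (forall w, null w -> f w = g w) -> sigma_measurable trace f.
Proof.
move=> mf mg fg B mB; rewrite sigma_traceE; split.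
  by rewrite -[X in measurable X]setTI; exact: mf.
exists (g @^-1` B); first exact: mg.
by apply/seteqP; split=> w [] /= Bw nw; split=> //=; [rewrite -fg|rewrite fg].
Qed.

Local Notation p := (pvalue H xi U).

Lemma pvalue_null w : null w -> p i w = U i w.
Proof.
by move=> /andP[/negbTE Hw _]; rewrite /pvalue Hw mulr0n subr0 mul1r mul0r addr0.
Qed.

Lemma measurable_pvalue_trace k : k != i -> sigma_measurable trace (p k).
Proof.
by move=> ki B mB; apply: others_trace; exact: measurable_pvalue_others.
Qed.

(** For [t >= gamma], hypothesis [i] contributes exactly 1 to the count in [ecdf p t] on [null], so
    there the value depends on the other p-values only. *)
Lemma ecdf_gen_trace : <<s ecdf_gen p gamma >> `<=` <<s trace >>.
Proof.
apply: smallest_sub; first exact: smallest_sigma_algebra.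
apply: gen_sub => t B; rewrite /= in_itv/= => /andP[tg _]; move: B.
apply: (@eq_on_null_trace _ (measurableTypeR R) _
  (fun w => n%:R^-1 * (1 + \sum_(k < n | k != i) (p k w <= t)%R%:R))).
- exact: measurable_ecdf.
- apply/sigma_measurableE; apply: measurable_funM => //.
  apply: measurable_funD => //.
  under eq_fun do rewrite big_mkcond/=.
  apply: measurable_sum => k; case: (boolP (k != i)) => // ki.
  apply: measurable_natr_bool; apply: measurable_fun_ler => //.
  by apply/sigma_measurableE; exact: measurable_pvalue_others.
move=> w Ew; rewrite /ecdf (bigD1 i)//= pvalue_null//.
by move: Ew => /andP[_ Uw]; rewrite (le_trans Uw tg).
Qed.

Hypothesis BI : BI_model P H xi U.
Hypotheses (gamma_gt0 : 0 < gamma) (gamma_le1 : gamma <= 1).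
Local Open Scope ereal_scope.

Let P_U (B : set R) : measurable B ->
  P (U i @^-1` (B `&` `]-oo, gamma])) =
  gamma%:E * uniform_prob gamma_gt0 B.
Proof.
move=> mB; rewrite -[LHS]/(distribution P (U i) _).
rewrite (BI_U_unif BI)//; last exact: measurableI.
by rewrite uniform_prob_le// divr1.
Qed.

Lemma indep_trace A B : <<s trace >> A -> measurable B ->
  P (A `&` null `&` U i @^-1` B) = P (A `&` null) * uniform_prob gamma_gt0 B.
Proof.
rewrite sigma_traceE => -[mA [A' oA' ->]] mB.
(* The event that hypothesis [i] is true belongs to [others]; what remains of [null] is a condition
   on [U i] alone. *)
have oH : <<s others H xi U i >> (A' `&` H i @^-1` [set false]).
  apply: (@measurableI _ Toth) => //; apply: sub_sigma_algebra; left; left.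
  exact: gen_preimage.
have nullE (C : set R) : A' `&` null `&` U i @^-1` C =
    (A' `&` H i @^-1` [set false]) `&` U i @^-1` (C `&` `]-oo, gamma]).
  apply/seteqP; split=> w; rewrite /null/= in_itv/=.
    by move=> [[A'w /andP[/negbTE -> Uw]] Cw].
  by move=> [[A'w ->] [Cw Uw]].
rewrite nullE (indep_others BI)//; last exact: measurableI.
(* The right-hand side is treated as the case [B = setT] of the left-hand side. *)
rewrite -[in RHS](setIT (A' `&` null)) -(preimage_setT (U i)) nullE.
rewrite (indep_others BI)//; last exact: measurableI.
rewrite !P_U// (@probability_setT _ _ _ (uniform_prob gamma_gt0)) mule1.
by rewrite muleA.
Qed.

(** Given [null], [U i] is uniform on [0, gamma] and independent of [trace], so it can be integrated
    out. *)
Lemma integral_null (f : g_sigma_algebraType trace * R -> \bar R) :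
  measurable_fun setT f -> (forall z, 0 <= f z) ->
  \int[P]_(w in null) f (w, U i w) =
  \int[P]_(w in null) \int[uniform_prob gamma_gt0]_u f (w, u).
Proof.
move=> mf f0; apply: (@integral_indep_on _ _ _ _ _ _ trace) => //.
- exact: trace_measurable.
- exact: trace_null.
- exact: (measurable_funPT (U i)).
- exact: indep_trace.
Qed.

Lemma integral_null_split (B : set R) (h : T -> R) :
  measurable B -> measurable_fun setT (h : g_sigma_algebraType trace -> R) ->
  (forall w, 0 <= h w)%R ->
  \int[P]_(w in null) (\1_B (U i w) * h w)%:E =
  uniform_prob gamma_gt0 B * \int[P]_(w in null) (h w)%:E.
Proof.
move=> mB mh h0.
pose f (z : g_sigma_algebraType trace * R) := (\1_B z.2 * h z.1)%:E.
have mf : measurable_fun setT f.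
  apply/measurable_EFinP; apply: measurable_funM.
    have m1 : measurable_fun setT (\1_B : R -> R) by exact: measurable_indic.
    exact: (measurableT_comp m1 measurable_snd).
  exact: (measurableT_comp mh measurable_fst).
have f0 z : 0 <= f z by rewrite lee_fin mulr_ge0.
have mhT : measurable_fun null (fun w => (h w)%:E).
  apply: measurable_funTS; apply/measurable_EFinP.
  apply: (measurable_sub_sigma trace_measurable) => //.
  exact: (@measurableT _ (g_sigma_algebraType trace)).
rewrite [LHS](integral_null mf f0) -(ge0_integralZl _ measurable_null mhT)//; last first.
  by move=> w _; rewrite lee_fin.
apply: eq_integral => w _; rewrite /f/=.
under eq_integral do rewrite mulrC EFinM.
rewrite ge0_integralZl ?lee_fin//; last first.
  by apply/measurable_EFinP; exact: measurable_indic.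
by rewrite integral_indic// setIT muleC.
Qed.

End trace.

(** * Step-down tests *)

Section step_down.
Context d (T : measurableType d) (R : realType) (n : nat).
Variables (p : 'I_n -> T -> R) (c : nat -> T -> R) (w : T).
Hypothesis c_homo : forall j k, (j <= k)%N -> c j w <= c k w.

(** Turns order statistics into counts, in which a single hypothesis can be isolated as one
    summand. *)
Lemma order_stat_le j x : (0 < j <= n)%N ->
  (order_stat p j w <= x) = (j <= \sum_(k < n) (p k w <= x)%R)%N.
Proof.
move=> /andP[j0 jn]; rewrite /order_stat.
set s := sort _ _.
have ss : sorted <=%R s by exact: (sort_sorted (@le_total _ R)).
have cs : count (<= x) s = (\sum_(k < n) (p k w <= x)%R)%N.
  rewrite /s (permP (permEl (perm_sort _ _))) count_map -sum1_count.
  by rewrite big_mkcond big_enum/=; apply: eq_bigr => k _ /=; case: ifP.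
have szs : size s = n by rewrite size_sort size_map size_enum_ord.
rewrite -cs; case: (leqP j) => jc.
  by apply: nth_count_le => //; rewrite prednK.
apply/negbTE; rewrite -ltNge; apply: nth_count_gt => //.
by rewrite szs -ltnS prednK// jc.
Qed.

(** The step down condition in terms of counts. The bound [r <= n] makes [passes n.+1] false, so
    that a largest passing number is also characterized when it is [n]. *)
Definition passes (r : nat) : bool := (r <= n)%N &&
  [forall j : 'I_n.+1, (0 < j <= r)%N ==> (j <= \sum_(k < n) (p k w <= c j w)%R)%N].

Lemma R_SD_passes : passes (R_SD p c w) && ~~ passes (R_SD p c w).+1.
Proof.
pose Q (r : 'I_n.+1) := [forall j : 'I_n.+1,
  (0 < j <= r)%N ==> (order_stat p j w <= c j w)].
have QE (r : 'I_n.+1) : Q r = passes r.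
  rewrite /passes -ltnS ltn_ord/=; apply: eq_forallb => j.
  case: (boolP (0 < j <= r)%N) => //= /andP[j0 _].
  by rewrite order_stat_le// j0 -ltnS ltn_ord.
have Q0 : Q ord0.
  by apply/forallP => j; apply/implyP; case: (nat_of_ord j).
(* The index 0 qualifies vacuously, so the maximum is attained. *)
have [r Qr Rr] : {r | r \in Q & R_SD p c w = r}.
  by apply: eq_bigmax_cond; apply/card_gt0P; exists ord0.
apply/andP; split; first by rewrite Rr -QE.
apply/negP => /[dup] pR /andP[Rn _].
have := @leq_bigmax_cond _ Q (@nat_of_ord n.+1) (@Ordinal n.+1 (R_SD p c w).+1 Rn).
by rewrite QE/= => /(_ pR); rewrite -/(R_SD p c w) ltnn.
Qed.

(** Hypothesis [i] is always counted, as if its p-value were 0, while the critical values are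
    kept. *)
Definition passes_without (i : 'I_n) (r : nat) : bool := (r <= n)%N &&
  [forall j : 'I_n.+1, (0 < j <= r)%N ==>
    (j <= 1 + \sum_(k < n | k != i) (p k w <= c j w)%R)%N].

Definition steps_without i r := passes_without i r && ~~ passes_without i r.+1.

(** [passes_without i] is inherited by smaller numbers, so it switches from true to false at most
    once. *)
Lemma steps_without_uniq i r r' :
  steps_without i r -> steps_without i r' -> r = r'.
Proof.
have anti s s' : passes_without i s -> (s' <= s)%N -> passes_without i s'.
  move=> /andP[sn /forallP H] s's; rewrite /passes_without (leq_trans s's sn)/=.
  apply/forallP => j; apply/implyP => /andP[j0 js'].
  by have /implyP := H j; apply; rewrite j0 (leq_trans js').
move=> /andP[pr nr] /andP[pr' nr']; apply/eqP; rewrite eqn_leq.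
by apply/andP; split; rewrite leqNgt; apply/negP => /anti ?;
   [apply: (negP nr')|apply: (negP nr)]; eauto.
Qed.

(* If hypothesis i is rejected, moving its p-value to 0 does not change the
   number of rejections. *)
Lemma R_SD_steps_without i : p i w <= c (R_SD p c w) w ->
  (0 < R_SD p c w)%N && steps_without i (R_SD p c w).
Proof.
set r := R_SD p c w => pi.
have /andP[/andP[rn /forallP Pr] nPr] : passes r && ~~ passes r.+1.
  exact: R_SD_passes.
have pr : passes_without i r.
  rewrite /passes_without rn/=; apply/forallP => j; apply/implyP => jr.
  have /implyP/(_ jr) := Pr j; rewrite (bigD1 i)//= => /leq_trans; apply.
  by rewrite leq_add2r leq_b1.
have npr : ~~ passes_without i r.+1.
  apply: contra nPr => /andP[rn' /forallP H].
  rewrite /passes rn'/=; apply/forallP => j; apply/implyP => /andP[j0 jr].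
  case: (leqP j r) => [jr'|rj].
    by have /implyP := Pr j; apply; rewrite j0.
  (* Here [j] is [r.+1]. Since [p i w <= c r w <= c j w], hypothesis [i] is genuinely counted and
     the two counts agree. *)
  have /implyP := H j; rewrite j0 jr => /(_ isT) /leq_trans; apply.
  by rewrite [leqRHS](bigD1 i)//= (le_trans pi)//; exact/c_homo/ltnW.
(* If [r] were 0, hypothesis [i] alone would already make [passes_without i 1] true. *)
rewrite /steps_without pr npr !andbT lt0n; apply: contra npr => /eqP r0.
rewrite /passes_without r0 (leq_ltn_trans _ (ltn_ord i))//=.
apply/forallP => j; apply/implyP => /andP[_ j1].
by rewrite (leq_trans j1).
Qed.

End step_down.

Lemma measurable_fun_invr_gt0 d (T : measurableType d) (R : realType)
    (f : T -> R) :
  measurable_fun setT f -> (forall x, 0 < f x) ->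
  measurable_fun setT (fun x => (f x)^-1).
Proof.
move=> mf f0; rewrite (_ : (fun _ => _) = (@powR R ^~ (-1)) \o f).
  by apply: measurableT_comp => //; exact: measurable_powR.
by apply/funext => x /=; rewrite powR_inv1// ltW.
Qed.

Lemma measurable_fun_forall d (T : measurableType d) (I : finType)
    (b : I -> T -> bool) :
  (forall j, measurable_fun setT (b j)) ->
  measurable_fun setT (fun x => [forall j, b j x]).
Proof.
move=> mb; apply: (@measurable_fun_bool _ _ _ _ true).
rewrite setTI (_ : _ @^-1` _ = \bigcap_(j in [set: I]) (b j @^-1` [set true])).
  apply: fin_bigcap_measurable => [|j _]; first exact: finite_finset.
  by rewrite -[X in measurable X]setTI; exact: mb.
apply/seteqP; split=> x /=.
  by move=> /forallP bx j _; exact: bx.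
by move=> bx; apply/forallP => j; exact: bx.
Qed.

Section integral_aux.
Context d (T : measurableType d) (R : realType).
Variable mu : {measure set T -> \bar R}.
Local Open Scope ereal_scope.

(* Unlike ge0_le_integral, f need not be measurable. *)
Lemma ge0_le_integral_lower (D : set T) (f g : T -> \bar R) :
  (forall x, D x -> 0 <= f x) -> (forall x, D x -> f x <= g x) ->
  \int[mu]_(x in D) f x <= \int[mu]_(x in D) g x.
Proof.
move=> f0 fg; have g0 x : D x -> 0 <= g x.
  by move=> Dx; exact: le_trans (f0 x Dx) (fg x Dx).
rewrite !ge0_integralE//; apply: ereal_sup_le => _ [h hf <-]; exists h => // x.
exact: le_trans (hf x) (lee_restrict fg x).
Qed.

End integral_aux.

(** * The number of true nulls with p-value below a threshold *)

Section true_nulls.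
Context d (T : measurableType d) (R : realType) (P : probability T R) (n : nat).
Variables (H : 'I_n -> {mfun T >-> bool}) (xi U : 'I_n -> {mfun T >-> R}).
Local Notation p := (pvalue H xi U).

Lemma pvalue_nullE i t w : (p i w <= t) && ~~ H i w = (w \in null H U i t).
Proof.
have [Hw|/negbTE Hw] := boolP (H i w); rewrite ?andbF ?andbT.
  by apply/esym/negbTE; rewrite notin_setE /null /= Hw.
rewrite /pvalue Hw mulr0n subr0 mul1r mul0r addr0.
by apply/idP/idP; rewrite inE /null /= Hw.
Qed.

Lemma V_null t w : V p H t w = \sum_(i < n) \1_(null H U i t) w.
Proof. by apply: eq_bigr => i _; rewrite pvalue_nullE indicE. Qed.

Lemma V_ge0 t w : 0 <= V p H t w.
Proof. exact: sumr_ge0. Qed.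

Lemma measurable_V t : measurable_fun setT (V p H t).
Proof.
rewrite (_ : V p H t = fun w => \sum_(i < n) \1_(null H U i t) w).
  by apply: measurable_sum => i; apply: measurable_indic; exact: measurable_null.
by apply/funext => w; exact: V_null.
Qed.

Local Open Scope ereal_scope.

Lemma integral_V t (k : T -> R) : measurable_fun setT k ->
  (forall w, (0 <= k w)%R) ->
  \int[P]_w (V p H t w * k w)%:E =
  \sum_(i < n) \int[P]_(w in null H U i t) (k w)%:E.
Proof.
move=> mk k0.
under eq_integral do rewrite V_null mulr_suml -sumEFin.
rewrite ge0_integral_sum//; last 2 first.
- move=> i; apply/measurable_EFinP; apply: measurable_funM => //.
  by apply: measurable_indic; exact: measurable_null.
- by move=> i w _; rewrite lee_fin mulr_ge0.
apply: eq_bigr => i _; rewrite [RHS]integral_mkcond; apply: eq_integral => w _.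
by rewrite patchE indicE; case: ifP; rewrite ?mul1r ?mul0r.
Qed.

End true_nulls.

(** * The FDR bound for adaptive step down tests *)

Section adaptive_step_down.
Context d (T : measurableType d) (R : realType) (P : probability T R) (n : nat).
Variables (H : 'I_n -> {mfun T >-> bool}) (xi U : 'I_n -> {mfun T >-> R}).
Variables (alpha lambda : R) (n0 : T -> R).
Local Notation p := (pvalue H xi U).
Hypotheses (alpha_gt0 : 0 < alpha) (lambda_gt0 : 0 < lambda).
Hypotheses (lambda_le1 : lambda <= 1).
Hypothesis BI : BI_model P H xi U.
Hypothesis mn0 : sigma_measurable (ecdf_gen p lambda) n0.
Hypothesis n0_gt0 : forall w, 0 < n0 w.
Local Notation crit := (adaptive_crit alpha lambda n0).

Lemma crit_homo w j k : (j <= k)%N -> crit j w <= crit k w.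
Proof.
move=> jk; rewrite /adaptive_crit le_min ge_min ge_min lexx orbT andbT.
by rewrite ler_wpM2r ?(ltW alpha_gt0)// ler_wpM2r ?invr_ge0 ?(ltW (n0_gt0 w))// ler_nat.
Qed.

Lemma crit_le w j : crit j w <= lambda.
Proof. by rewrite /adaptive_crit ge_min lexx orbT. Qed.

Lemma crit_gt0 w j : 0 < crit j.+1 w.
Proof.
by rewrite /adaptive_crit lt_min lambda_gt0 andbT mulr_gt0// divr_gt0.
Qed.

Lemma crit_leM w j : crit j w <= j%:R * (alpha / n0 w).
Proof. by rewrite /adaptive_crit ge_min mulrA mulrAC lexx. Qed.

(* The share of a true null hypothesis i in V_SD / R_SD, as a function of its
   p-value z.2, the other p-values being kept fixed. *)
Definition share (i : 'I_n) (z : T * R) : R :=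
  \sum_(r < n) (steps_without p crit z.1 i r.+1 &&
    (z.2 <= crit r.+1 z.1))%R%:R / r.+1%:R.

Lemma share_ge0 i z : 0 <= share i z.
Proof. by apply: sumr_ge0 => r _; rewrite divr_ge0. Qed.

Section one_hypothesis.
Variable i : 'I_n.
Local Notation null_i := (null H U i lambda).
Local Notation TG := (g_sigma_algebraType (trace H xi U i lambda)).
Local Notation steps := (steps_without p crit).

Let mn0_trace : sigma_measurable (trace H xi U i lambda) n0.
Proof. by move=> B mB; apply: ecdf_gen_trace; exact: mn0. Qed.

Let minv : measurable_fun setT (fun w : TG => (n0 w)^-1).
Proof.
by apply: measurable_fun_invr_gt0 => //; exact/sigma_measurableE.
Qed.

Let mcrit j : measurable_fun setT (crit j : TG -> R).
Proof.
apply: measurable_minr => //; apply: measurable_funM => //.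
exact: measurable_funM.
Qed.

Let mpasses r : measurable_fun setT (fun w : TG => passes_without p crit w i r).
Proof.
apply: measurable_and => //; apply: measurable_fun_forall => j.
apply: (@measurable_fun_ifT _ _ _ _ _ _ (fun=> _)) => //.
(* The count is compared in [R], where sums and comparisons of measurable functions are
   measurable. *)
rewrite (_ : (fun _ => _) = fun w : TG => j%:R <=
    1 + \sum_(k < n | k != i) (p k w <= crit j w)%R%:R :> R); last first.
  by apply/funext => w; rewrite -(ler_nat R) natrD natr_sum.
apply: measurable_fun_ler => //; apply: measurable_funD => //.
under eq_fun do rewrite big_mkcond/=.
apply: measurable_sum => k; case: (boolP (k != i)) => // ki.
apply: measurable_natr_bool; apply: measurable_fun_ler => //.
by apply/sigma_measurableE; exact: measurable_pvalue_trace.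
Qed.

Let msteps r : measurable_fun setT (fun w : TG => steps w i r).
Proof.
apply: measurable_and => //; exact: measurable_neg.
Qed.

Let mshare : measurable_fun setT (share i : TG * R -> R).
Proof.
apply: measurable_sum => r; apply: measurable_funM => //.
apply: measurable_natr_bool; apply: measurable_and.
  exact: (measurableT_comp (msteps r.+1) measurable_fst).
apply: measurable_fun_ler => //.
exact: (measurableT_comp (mcrit r.+1) measurable_fst).
Qed.

Lemma measurable_share_U : measurable_fun setT (fun w => share i (w, U i w)).
Proof.
apply: (measurableT_comp (f := share i : TG * R -> R)); first exact: mshare.
apply: measurable_fun_pair; last exact: measurable_funPT.
move=> _ A GA; rewrite setTI; exact: trace_measurable GA.
Qed.

(** At most one summand is 1, by [steps_without_uniq]. *)
Let sum_steps_le1 w : \sum_(r < n) (steps w i r.+1)%:R <= 1 :> R.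
Proof.
have [[r sr]|nos] := pselect (exists r : 'I_n, steps w i r.+1).
  rewrite (bigD1 r)//= sr big1 ?addr0// => s sr'.
  case: (boolP (steps w i s.+1)) => // /(steps_without_uniq sr) [rs].
  by move: sr'; rewrite -(inj_eq val_inj)/= rs eqxx.
rewrite big1// => r _; case: (boolP (steps w i r.+1)) => // sr.
by exfalso; apply: nos; exists r.
Qed.

Local Open Scope ereal_scope.

(** A uniform variable on [0, lambda] is at most [crit r.+1 w] with probability at most (r + 1)
    alpha / (lambda n0). Division by r + 1 removes the dependence on [r], and the step indicators
    sum to at most 1. *)
Let integral_share w :
  \int[uniform_prob lambda_gt0]_u (share i (w, u))%:E <=
  ((alpha / lambda) * (n0 w)^-1)%:E.
Proof.
under eq_integral do rewrite -sumEFin.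
rewrite ge0_integral_sum//; last first.
  move=> r; apply/measurable_EFinP; apply: measurable_funM => //.
  apply: measurable_natr_bool; apply: measurable_and => //=.
  exact: measurable_fun_ler.
apply: (@le_trans _ _ (\sum_(r < n)
   ((steps w i r.+1)%:R * (alpha / lambda / n0 w))%:E)); last first.
  rewrite sumEFin lee_fin -mulr_suml ler_piMl//.
  by rewrite divr_ge0// ?ltW// divr_gt0.
apply: lee_sum => r _.
under eq_integral => u _.
  rewrite (_ : _ / _ = (steps w i r.+1)%:R / r.+1%:R *
      \1_(`]-oo, crit r.+1 w]%classic : set R) u)%R; last first.
    rewrite indicE mem_setE /= in_itv/=.
    by rewrite mulrAC -natrM mulnb.
  rewrite EFinM.
  over.
rewrite ge0_integralZl//; last first.
  by apply/measurable_EFinP; exact: measurable_indic.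
rewrite integral_indic// setIT.
rewrite [X in _ * X](uniform_prob_itv lambda_gt0 (crit_gt0 w r) (crit_le w r.+1)).
rewrite -EFinM lee_fin mulrACA -[leLHS]mulrA ler_wpM2l// -invfM.
rewrite ler_pdivrMr ?mulr_gt0//; apply: le_trans (crit_leM w r.+1) _.
rewrite le_eqVlt; apply/orP; left; apply/eqP; field.
by rewrite !gt_eqF.
Qed.

Lemma expected_share : \int[P]_(w in null_i) (share i (w, U i w))%:E <=
  (alpha / lambda)%:E * \int[P]_(w in null_i) ((n0 w)^-1)%:E.
Proof.
have mD : measurable null_i by exact: measurable_null.
have mshareE : measurable_fun setT (EFin \o (share i : TG * R -> R)).
  exact/measurable_EFinP.
have -> : \int[P]_(w in null_i) (share i (w, U i w))%:E =
    \int[P]_(w in null_i) \int[uniform_prob lambda_gt0]_u (share i (w, u))%:E.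
  by apply: (integral_null BI lambda_gt0 lambda_le1 mshareE) => z;
     rewrite lee_fin share_ge0.
rewrite -ge0_integralZl//; last 3 first.
- apply: measurable_funTS; apply/measurable_EFinP.
  apply: (measurable_sub_sigma (@trace_measurable _ _ _ _ H xi U i lambda)) => //.
  exact: (@measurableT _ TG).
- by move=> w _; rewrite lee_fin invr_ge0 ltW.
- by rewrite lee_fin divr_ge0// ltW.
apply: ge0_le_integral_lower => w _; last exact: integral_share.
by apply: integral_ge0 => u _; rewrite lee_fin share_ge0.
Qed.

End one_hypothesis.
(** If a true null [i] is rejected, then [p i w = U i w] is at most [lambda], and one term of its
    share equals [1 / R_SD]; all other terms are nonnegative. *)
Let rejected_share w : V_SD p H crit w / (maxn (R_SD p crit w) 1)%:R <=
  \sum_(i < n) \1_(null H U i lambda) w * share i (w, U i w).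
Proof.
rewrite /V_SD mulr_suml; apply: ler_sum => i _.
have [/andP[pi Hi]|_] := boolP (_ && _); last first.
  by rewrite mul0r mulr_ge0// share_ge0.
have nw : w \in null H U i lambda.
  by rewrite -(pvalue_nullE H xi) Hi (le_trans pi)// crit_le.
have /andP[R0 st] := R_SD_steps_without (@crit_homo w) pi.
(* The predecessor appears because the summation index [r] of [share] stands for [r.+1]
   rejections. *)
have Rn : ((R_SD p crit w).-1 < n)%N.
  by case/andP: st => /andP[Rn _] _; rewrite prednK.
rewrite indicE nw !mul1r /share (bigD1 (Ordinal Rn))//= prednK// st/=.
have Ui : p i w = U i w by apply: pvalue_null; rewrite inE in nw; exact: nw.
rewrite -Ui pi (maxn_idPl R0) mul1r lerDl.
by apply: sumr_ge0 => r _; rewrite divr_ge0.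
Qed.

Local Open Scope ereal_scope.

Lemma measurable_estimator_inv : measurable_fun setT (fun w => (n0 w)^-1)%R.
Proof.
apply: measurable_fun_invr_gt0 => //.
apply: (@measurable_sub_sigma _ _ (ecdf_gen p lambda)).
- exact: ecdf_gen_measurable.
- exact: (@measurableT _ (g_sigma_algebraType _)).
- exact/sigma_measurableE.
Qed.

(** Sum [expected_share] over the hypotheses; [integral_V] reassembles the right-hand side. *)
Lemma FDR_SD_le : FDR_SD p H P crit <=
  (alpha / lambda)%:E * 'E_P[fun w => (V p H lambda w / n0 w)%R].
Proof.
rewrite /FDR_SD unlock integral_V//; last 2 first.
- exact: measurable_estimator_inv.
- by move=> w; rewrite invr_ge0 ltW.
rewrite ge0_sume_distrr; last first.
  by move=> i _; apply: integral_ge0 => w _; rewrite lee_fin invr_ge0 ltW.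
apply: (@le_trans _ _ (\int[P]_w (\sum_(i < n)
    \1_(null H U i lambda) w * share i (w, U i w))%:E)).
  apply: ge0_le_integral_lower => w _; rewrite lee_fin; last exact: rejected_share.
  by rewrite divr_ge0// V_ge0.
under eq_integral do rewrite -sumEFin.
rewrite ge0_integral_sum//; last 2 first.
- move=> i; apply/measurable_EFinP; apply: measurable_funM.
    by apply: measurable_indic; exact: measurable_null.
  exact: measurable_share_U.
- by move=> i w _; rewrite lee_fin mulr_ge0// share_ge0.
apply: lee_sum => i _; apply: le_trans (expected_share i).
rewrite [leRHS]integral_mkcond le_eqVlt; apply/orP; left; apply/eqP.
apply: eq_integral => w _.
by rewrite patchE indicE; case: ifP; rewrite ?mul1r ?mul0r.
Qed.

End adaptive_step_down.

(** * Generalized Storey estimators *)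

(** Rectangles generate the product sigma-algebra, and the preimage of a rectangle under the pair is
    an intersection of two events of [<<s G >>]. *)
Lemma sigma_measurable_comp2 (T : Type) (R : realType) (G : set (set T))
    (f g : T -> R) (phi : R * R -> R) :
  sigma_measurable G f -> sigma_measurable G g -> measurable_fun setT phi ->
  sigma_measurable G (fun x => phi (f x, g x)).
Proof.
move=> mf mg mphi B mB.
rewrite -[X in <<s G >> X]/((fun x => (f x, g x)) @^-1` (phi @^-1` B)).
have : measurable (phi @^-1` B) by rewrite -[X in measurable X]setTI; exact: mphi.
rewrite measurable_prod_measurableType.
apply: sigma_preimage => _ [C mC [D mD <-]].
rewrite (_ : _ @^-1` _ = f @^-1` C `&` g @^-1` D)//.
have [_ GC GU] := smallest_sigma_algebra setT G.
(* The intersection is the complement of a union of complements, and [bigcup2] turns that into a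
   countable union. *)
rewrite -(setCK (_ `&` _)) setCI -!setTD; apply: (GC); rewrite -bigcup2E.
by apply: GU => -[|[|k]] /=; [apply: GC; exact: mf|apply: GC; exact: mg|
  exact: sigma_algebra0].
Qed.

Section storey.
Context d (T : measurableType d) (R : realType) (P : probability T R) (n : nat).
Variables (H : 'I_n -> {mfun T >-> bool}) (xi U : 'I_n -> {mfun T >-> R}).
Variables (lambda lambda1 gamma : R).
Local Notation p := (pvalue H xi U).
Hypothesis BI : BI_model P H xi U.
Hypotheses (lambda_gt0 : 0 < lambda) (lambda_le : lambda <= lambda1).
Hypotheses (lambda1_lt : lambda1 < gamma) (gamma_le1 : gamma <= 1).

Let gamma_gt0 : 0 < gamma.
Proof. exact: lt_trans (lt_le_trans lambda_gt0 lambda_le) lambda1_lt. Qed.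

Let n_gt0 : 0 < n%:R :> R.
Proof. by rewrite ltr0n; exact: BI_n_gt0 BI. Qed.

(** The factor [n] cancels; the leading 1 comes from the added 1 / n and keeps the estimator
    positive. *)
Lemma storeyE w : storey p lambda1 gamma w =
  (1 + \sum_(i < n) (lambda1 < p i w <= gamma)%R%:R) / (gamma - lambda1).
Proof.
rewrite /storey mulrA; congr (_ / _).
rewrite /ecdf -mulrBr -[X in _ * (_ + X)]mulr1 -mulrDr mulVKf ?gt_eqF//.
rewrite addrC; congr (_ + _); rewrite -sumrB; apply: eq_bigr => i _.
case: (ltP lambda1 (p i w)) => [lp|pl]; first by rewrite subr0.
by rewrite (le_trans pl (ltW lambda1_lt)) subrr.
Qed.

Lemma storey_gt0 w : 0 < storey p lambda1 gamma w.
Proof.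
by rewrite storeyE divr_gt0 ?subr_gt0// ltr_pwDl// sumr_ge0.
Qed.

Lemma storey_estimator : ecdf_estimator p lambda (storey p lambda1 gamma).
Proof.
split; last exact: storey_gt0.
exists (fun f => n%:R * ((f gamma - f lambda1 + n%:R^-1) / (gamma - lambda1))) => //.
have mev t : lambda <= t <= 1 ->
    sigma_measurable (evaluations lambda) (fun f : R -> R => f t).
  move=> tl B mB; apply: sub_sigma_algebra.
  by apply: (@gen_preimage _ _ _ _ _ (fun (t : R) (f : R -> R) => f t)) => //=;
     rewrite in_itv.
apply: (@sigma_measurable_comp2 _ _ _ (fun f => f gamma) (fun f => f lambda1)
  (fun z => n%:R * ((z.1 - z.2 + n%:R^-1) / (gamma - lambda1)))).
- by apply: mev; rewrite gamma_le1 andbT (le_trans lambda_le)// ltW.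
- by apply: mev; rewrite lambda_le (le_trans (ltW lambda1_lt)).
apply: measurable_funM => //; apply: measurable_funM => //.
by apply: measurable_funD => //; exact: measurable_funB.
Qed.

(** With M the number of all p-values in ]lambda1, gamma], this is M + 1 if [p i w <= lambda1] and M
    if [p i w] lies in that interval. It does not involve [p i]. *)
Local Notation others_between i w :=
  ((1 : R) + \sum_(k < n | k != i) (lambda1 < p k w <= gamma)%R%:R)%R.

Local Open Scope ereal_scope.

Section one_hypothesis.
Variable i : 'I_n.
Local Notation null_i := (null H U i gamma).
Local Notation TG := (g_sigma_algebraType (trace H xi U i gamma)).

Let h (A : set T) (w : T) : R := (\1_A w / others_between i w)%R.

Let others_gt0 w : (0 < others_between i w)%R.
Proof. by rewrite ltr_pwDl// sumr_ge0. Qed.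

Let h_ge0 A w : (0 <= h A w)%R.
Proof. by rewrite divr_ge0// ltW. Qed.

Let mh A : <<s ecdf_gen p gamma >> A -> measurable_fun setT (h A : TG -> R).
Proof.
move=> GA; apply: measurable_funM.
  by apply: measurable_indic; exact: ecdf_gen_trace.
apply: measurable_fun_invr_gt0 => [|w]; last exact: others_gt0.
apply: measurable_funD => //.
under eq_fun do rewrite big_mkcond/=.
apply: measurable_sum => k; case: (boolP (k != i)) => // ki.
have mpk : measurable_fun setT (p k : TG -> R).
  by apply/sigma_measurableE; exact: measurable_pvalue_trace.
apply: measurable_natr_bool; apply: measurable_and.
  exact: measurable_fun_ltr.
exact: measurable_fun_ler.
Qed.

Let h_on_null A w : null H U i lambda w ->
  (\1_A w / storey p lambda1 gamma w = (gamma - lambda1) * h A w)%R.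
Proof.
move=> nw; rewrite storeyE (bigD1 i)//= (pvalue_null xi nw).
move: nw => /andP[_ Ul]; rewrite ltNge (le_trans Ul lambda_le)/= add0r.
by rewrite /h invf_div mulrCA.
Qed.

(* Given the other p-values, U i falls into [0, lambda] and ]lambda1, gamma]
   with probabilities proportional to lambda and gamma - lambda1. *)
Lemma integral_exchange A : <<s ecdf_gen p gamma >> A ->
  \int[P]_(w in null H U i lambda) (\1_A w / storey p lambda1 gamma w)%:E =
  lambda%:E * \int[P]_(w in null_i) (\1_(~` `]-oo, lambda1]) (U i w) *
    (\1_A w / others_between i w))%:E.
Proof.
move=> GA.
have mhA := mh GA; have mnull : measurable null_i by exact: measurable_null.
have lambda1_gt0 : (0 < lambda1)%R by exact: lt_le_trans lambda_le.
have lambda_lt : (lambda < gamma)%R by exact: le_lt_trans lambda1_lt.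
have mB : measurable (~` `]-oo, lambda1]%classic : set R) by exact: measurableC.
rewrite [X in _ = _ * X](integral_null_split BI gamma_gt0 gamma_le1 mB mhA (h_ge0 A)).
(* The smaller event becomes an indicator of [U i] on [null_i], so that [integral_null_split] also
   applies to this side. *)
transitivity (\int[P]_(w in null_i)
    (\1_(`]-oo, lambda]%classic : set R) (U i w) * ((gamma - lambda1) * h A w))%:E).
  rewrite integral_mkcond [RHS]integral_mkcond; apply: eq_integral => w _.
  rewrite !patchE.
  have -> : \1_(`]-oo, lambda]%classic : set R) (U i w) = (U i w <= lambda)%R%:R :> R.
    by rewrite indicE mem_setE in_itv.
  have [|nw] := boolP (w \in null H U i lambda).
    rewrite inE => nw; rewrite h_on_null//; case/andP: (nw) => Hw Ul.
    by rewrite ifT ?Ul ?mul1r// inE /null/= Hw (le_trans Ul)// ltW.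
  case: ifPn => //; rewrite inE => /andP[Hw _].
  by move: nw; rewrite notin_setE /null /= Hw/= => /negP/negbTE ->; rewrite mul0r.
rewrite [LHS](integral_null_split (h := fun w => ((gamma - lambda1) * h A w)%R)
  BI gamma_gt0 gamma_le1)//; last 2 first.
- exact: measurable_funM.
- by move=> w; rewrite mulr_ge0// subr_ge0 ltW.
under eq_integral do rewrite EFinM.
rewrite ge0_integralZl//; last 3 first.
- apply: measurable_funTS; apply/measurable_EFinP.
  apply: (measurable_sub_sigma (@trace_measurable _ _ _ _ H xi U i gamma)) => //.
  exact: (@measurableT _ TG).
- by move=> w _; rewrite lee_fin.
- by rewrite lee_fin subr_ge0 ltW.
rewrite !muleA; congr (_ * _).
(* The constants agree: (lambda / gamma) (gamma - lambda1) = lambda (1 - lambda1 / gamma). *)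
rewrite [X in X * _](uniform_prob_itv gamma_gt0 lambda_gt0 (ltW lambda_lt)).
rewrite (@probability_setC _ _ _ (uniform_prob gamma_gt0))//.
rewrite [X in _ = _ * (_ - X)](uniform_prob_itv gamma_gt0 lambda1_gt0 (ltW lambda1_lt)).
rewrite -!EFinB -!EFinM; congr (_%:E).
by field; rewrite gt_eqF.
Qed.

Lemma measurable_exchange_integrand A : <<s ecdf_gen p gamma >> A ->
  measurable_fun setT (fun w => \1_(~` `]-oo, lambda1]) (U i w) *
    (\1_A w / others_between i w))%R.
Proof.
move=> GA; apply: measurable_funM.
  have m1 : measurable_fun setT (\1_(~` `]-oo, lambda1]) : R -> R).
    by apply: measurable_indic; exact: measurableC.
  exact: (measurableT_comp m1).
apply: (measurable_sub_sigma (@trace_measurable _ _ _ _ H xi U i gamma)).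
  exact: (@measurableT _ TG).
exact: mh.
Qed.

End one_hypothesis.

(** Each true null with p-value in ]lambda1, gamma] contributes 1 / S on [A], where S counts all
    p-values in that interval, so at most S terms are nonzero. *)
Let sum_between (A : set T) w :
  (\sum_(i < n) \1_(null H U i gamma) w * (\1_(~` `]-oo, lambda1]) (U i w) *
    (\1_A w / others_between i w)) <= \1_A w :> R)%R.
Proof.
set S := (\sum_(k < n) (lambda1 < p k w <= gamma)%R%:R : R)%R.
apply: (@le_trans _ _
    (\sum_(i < n) (lambda1 < p i w <= gamma)%R%:R * (\1_A w / S))%R).
  apply: ler_sum => i _; rewrite mulrA.
  rewrite {1}indicE -(pvalue_nullE H xi).
  have [/andP[pg Hi]|_] := boolP (_ && _); last first.
    by rewrite !mul0r mulr_ge0// divr_ge0// sumr_ge0.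
  have Ui : p i w = U i w by rewrite /pvalue (negbTE Hi) mulr0n subr0 mul1r mul0r addr0.
  rewrite mul1r indicE in_setC mem_setE/= in_itv/= -Ui -ltNge pg andbT.
  have [lp|_] := boolP (lambda1 < p i w)%R; last by rewrite !mul0r.
  by rewrite /S [in leRHS](bigD1 i)//= lp pg.
(* For [S = 0] the factor in front makes the product vanish, whatever 1 / S is. *)
rewrite -mulr_suml -/S; have [->|S0] := eqVneq S 0%R.
  by rewrite mul0r.
by rewrite mulrCA divff// mulr1.
Qed.

(** The conditional bound in integrated form: [integral_exchange] for each hypothesis, then
    [sum_between] pointwise. *)
Lemma integral_storey_le A : <<s ecdf_gen p gamma >> A ->
  \int[P]_(w in A) (V p H lambda w / storey p lambda1 gamma w)%:E <=
  lambda%:E * P A.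
Proof.
move=> GA; have mA := ecdf_gen_measurable GA.
have mS : measurable_fun setT (fun w => (storey p lambda1 gamma w)^-1)%R.
  apply: measurable_fun_invr_gt0 => [|w]; last exact: storey_gt0.
  apply: measurable_funM => //; apply: measurable_funM => //.
  by apply: measurable_funD => //; apply: measurable_funB; exact: measurable_ecdf.
have -> : \int[P]_(w in A) (V p H lambda w / storey p lambda1 gamma w)%:E =
    \int[P]_w (V p H lambda w * (\1_A w / storey p lambda1 gamma w))%:E.
  rewrite integral_mkcond; apply: eq_integral => w _.
  by rewrite patchE indicE; case: ifP; rewrite ?mul1r// mul0r mulr0.
rewrite integral_V; last 2 first.
- by apply: measurable_funM => //; exact: measurable_indic.
- by move=> w; rewrite divr_ge0// ltW// storey_gt0.
under eq_bigr do rewrite integral_exchange//.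
rewrite -ge0_sume_distrr; last first.
  move=> i _; apply: integral_ge0 => w _; rewrite lee_fin !mulr_ge0// invr_ge0.
  by rewrite addr_ge0// sumr_ge0.
rewrite lee_pmul2l//; apply: (@le_trans _ _ (\int[P]_w (\sum_(i < n)
  \1_(null H U i gamma) w * (\1_(~` `]-oo, lambda1]) (U i w) *
    (\1_A w / others_between i w)))%:E)).
  under [leRHS]eq_integral do rewrite -sumEFin.
  rewrite ge0_integral_sum//; last 2 first.
  - move=> i; apply/measurable_EFinP; apply: measurable_funM.
      by apply: measurable_indic; exact: measurable_null.
    exact: measurable_exchange_integrand.
  - move=> i w _; rewrite lee_fin !mulr_ge0// invr_ge0.
    by rewrite addr_ge0// sumr_ge0.
  apply: lee_sum => i _; rewrite [leLHS]integral_mkcond le_eqVlt.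
  apply/orP; left; apply/eqP; apply: eq_integral => w _.
  by rewrite patchE [in RHS]indicE; case: ifP; rewrite ?mul1r ?mul0r.
have -> : P A = \int[P]_w (\1_A w)%:E by rewrite integral_indic// setIT.
apply: ge0_le_integral_lower => w _; rewrite lee_fin; last exact: sum_between.
apply: sumr_ge0 => i _; rewrite !mulr_ge0// invr_ge0.
by rewrite addr_ge0// sumr_ge0.
Qed.

End storey.

(** * Conditional expectations and mixtures *)

Section density.
Context d (T : measurableType d) (R : realType).
Variables (mu : {measure set T -> \bar R}) (f : T -> \bar R).
Local Open Scope ereal_scope.

Definition density & measurable_fun setT f & (forall x, 0 <= f x) :=
  fun A : set T => \int[mu]_(x in A) f x.

Hypotheses (mf : measurable_fun setT f) (f0 : forall x, 0 <= f x).

Let density0 : density mf f0 set0 = 0.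
Proof. exact: integral_set0. Qed.

Let density_ge0 A : 0 <= density mf f0 A.
Proof. exact: integral_ge0. Qed.

Let density_sigma_additive : semi_sigma_additive (density mf f0).
Proof.
move=> F mF tF mUF; rewrite /density ge0_integral_bigcup//; last first.
  exact: measurable_funTS.
by apply: is_cvg_nneseries => k _ _; exact: integral_ge0.
Qed.

HB.instance Definition _ := isMeasure.Build _ _ _ (density mf f0)
  density0 density_ge0 density_sigma_additive.

End density.

Section conditional_expectation.
Context d (T : measurableType d) (R : realType) (P : probability T R).
Variables (G : set (set T)) (X : T -> R) (c : R).
Hypothesis mG : <<s G >> `<=` measurable.
Hypotheses (mX : measurable_fun setT X) (X0 : forall w, 0 <= X w).
Local Open Scope ereal_scope.
Local Notation TG := (g_sigma_algebraType G).

Lemma cond_expectation_le_integral A : (0 <= c)%R ->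
  cond_expectation_le P G X c ->
  <<s G >> A -> \int[P]_(w in A) (X w)%:E <= c%:E * P A.
Proof.
move=> c0 [Y [mY YX] Yc] GA; have mA := mG GA.
rewrite -YX// -integral_cst//.
have mYA : measurable_fun A Y.
  apply: measurable_funTS.
  apply: (measurable_sub_sigma mG); last exact/sigma_measurableE.
  exact: (@measurableT _ TG).
(* The version [Y] may take negative values, so the comparison goes through its positive part. *)
apply: (@le_trans _ _ (\int[P]_(w in A) Y^\+ w)).
  rewrite [leLHS]integralE -[leRHS]adde0 leeD2l// oppe_le0.
  exact: integral_ge0.
apply: ae_ge0_le_integral => //.
- exact: measurable_funepos.
- by apply: filterS Yc => w Ywc _; rewrite funeposE ge_max Ywc lee_fin.
Qed.

(** The version is the Radon-Nikodym derivative, on [<<s G >>], of the measure with density [X]. The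
    hypothesis makes this measure finite and absolutely continuous. *)
Lemma cond_expectation_leI :
  (forall A, <<s G >> A -> \int[P]_(w in A) (X w)%:E <= c%:E * P A) ->
  cond_expectation_le P G X c.
Proof.
move=> Xc.
have mXE : measurable_fun setT (EFin \o X) by exact/measurable_EFinP.
have XE0 w : 0 <= (EFin \o X) w by rewrite lee_fin.
have c0 : (0 <= c)%R.
  rewrite -lee_fin -[c%:E]mule1 -(@probability_setT _ _ _ P).
  apply: le_trans (Xc setT (@measurableT _ TG)).
  by apply: integral_ge0 => w _; rewrite lee_fin.
have moo : density P mXE XE0 setT < +oo.
  apply: (le_lt_trans (Xc setT (@measurableT _ TG))).
  by rewrite probability_setT mule1 ltry.
pose PG := sub_measure P mG.
(* Restricting to [setT] leaves the measure unchanged and records that it is finite. *)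
pose nu := sub_measure (mfrestr measurableT moo) mG.
have nuE A : nu A = \int[P]_(w in A) (X w)%:E.
  by rewrite /nu /= /sub_measure /= /mfrestr /mrestr /density setIT.
have nuP : nu `<< PG.
  apply/null_content_dominatesP => A GA PA0; apply/eqP.
  rewrite eq_le measure_ge0 andbT nuE (le_trans (Xc A GA))//.
  by rewrite [P A]PA0 mule0.
have [f [f0 fi fE]] := radon_nikodym_finite nuP.
have mf : measurable_fun setT f by exact: measurable_int fi.
have PfE A : <<s G >> A -> \int[P]_(w in A) f w = \int[P]_(w in A) (X w)%:E.
  move=> GA; rewrite -nuE; apply: etrans (esym (fE A GA)); apply: esym.
  by apply: (ge0_integral_sub_measure P mG GA) => //; exact: measurable_funTS.
exists f; first by split => //; exact/sigma_measurableE.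
pose D : set T := [set w | c%:E < f w].
have GD : <<s G >> D.
  rewrite (_ : D = f @^-1` `]c%:E, +oo[); last first.
    apply/seteqP; split=> w; rewrite /D/= in_itv/= ?andbT//.
  by rewrite -[X in <<s G >> X]setTI; apply: mf => //; exact: emeasurable_itv.
(* On each part of [D] in [<<s G >>] the integral of [f] is at most that of [c] by hypothesis, and
   at least that by the choice of [D]. Hence [f = c] almost everywhere on [D], where [f > c], so [D]
   is negligible. *)
have : ae_eq PG D f (cst c%:E).
  apply: integral_ae_eq => //; first exact: integrableS fi.
  move=> E ED GE; apply/eqP; rewrite eq_le; apply/andP; split.
    have <- : nu E = \int[PG]_(x in E) f x by exact: fE.
    by rewrite nuE integral_cst//; exact: Xc.
  apply: ge0_le_integral_lower => w Ew; rewrite ?lee_fin//.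
  exact/ltW/ED.
move=> [N [GN N0 DN]]; exists N; split => //; first exact: mG.
move=> w /= fw; apply: DN => /= Df; apply: fw.
case: (leP (f w) c%:E) => // cf.
by have := Df cf; move=> fc; rewrite fc ltxx in cf.
Qed.

End conditional_expectation.

(** * Weights as mixtures of superlevel sets *)

Section layer_cake.
Context d (T : measurableType d) (R : realType) (P : probability T R).
Variable b : T -> R.
Hypotheses (mb : measurable_fun setT b) (b01 : forall w, 0 <= b w <= 1).
Local Open Scope ereal_scope.

Let uniform_b w : uniform_prob (@ltr01 R) `]-oo, b w] = (b w)%:E.
Proof.
have /andP[] := b01 w; rewrite le_eqVlt => /orP[/eqP <- _|b0 b1]; last first.
  by rewrite uniform_prob_itv// divr1.
(* For [b w = 0] the half-line meets [0, 1] only in the point 0. *)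
rewrite /uniform_prob integral_uniform_pdf; apply: (@integral_Sset1 _ _ _ 0%R) => x.
by rewrite /= !in_itv/= => -[x0 /andP[x0' _]]; apply/eqP; rewrite eq_le x0 x0'.
Qed.

(** [b w] is the probability that a uniform variable is at most [b w]; exchange the integrals by
    Tonelli. *)
Lemma layer_cake (X : T -> R) :
  measurable_fun setT X -> (forall w, 0 <= X w)%R ->
  \int[P]_w (b w * X w)%:E =
  \int[uniform_prob (@ltr01 R)]_u \int[P]_(w in [set w | (u <= b w)%R]) (X w)%:E.
Proof.
move=> mX X0.
pose f (z : T * R) := (X z.1 * (z.2 <= b z.1)%R%:R)%:E.
have mf : measurable_fun setT f.
  apply/measurable_EFinP; apply: measurable_funM.
    exact: (measurableT_comp mX measurable_fst).
  apply: measurable_natr_bool; apply: measurable_fun_ler => //.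
  exact: (measurableT_comp mb measurable_fst).
have f0 z : 0 <= f z by rewrite lee_fin mulr_ge0.
transitivity (\int[P]_w \int[uniform_prob (@ltr01 R)]_u f (w, u)).
  apply: eq_integral => w _; rewrite /f/=.
  under eq_integral => u _.
    rewrite (_ : (u <= b w)%R%:R = \1_(`]-oo, b w]%classic : set R) u); last first.
      by rewrite indicE mem_setE in_itv.
    rewrite EFinM.
    over.
  rewrite ge0_integralZl ?lee_fin//; last first.
    by apply/measurable_EFinP; exact: measurable_indic.
  rewrite integral_indic// setIT [X in _ = _ * X]uniform_b.
  by rewrite -EFinM mulrC.
have -> := @fubini_tonelli _ _ _ _ _ P (uniform_prob (@ltr01 R)) f mf f0.
apply: eq_integral => u _; rewrite [RHS]integral_mkcond.
apply: eq_integral => w _; rewrite /f/= patchE.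
rewrite (_ : (w \in [set w | (u <= b w)%R]) = (u <= b w)%R); last first.
  by apply/idP/idP; rewrite inE.
by case: ifP; rewrite ?mulr1// mulr0.
Qed.

End layer_cake.

(** The superlevel sets of [b] lie in [<<s G >>], so the bound holds on each of them. Writing both
    sides by [layer_cake], the right one with the constant [c] as integrand, mixes these bounds. *)
Lemma le_integral_weight d (T : measurableType d) (R : realType)
    (P : probability T R) (G : set (set T)) (X b : T -> R) (c : R) :
  <<s G >> `<=` measurable ->
  measurable_fun setT X -> (forall w, 0 <= X w) -> 0 <= c ->
  sigma_measurable G b -> (forall w, 0 <= b w <= 1) ->
  (forall A, <<s G >> A ->
     \int[P]_(w in A) (X w)%:E <= c%:E * P A)%E ->
  (\int[P]_w (b w * X w)%:E <= c%:E * \int[P]_w (b w)%:E)%E.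
Proof.
move=> mG mX X0 c0 Gb b01 Xc.
have mb : measurable_fun setT b.
  apply: (measurable_sub_sigma mG); last exact/sigma_measurableE.
  exact: (@measurableT _ (g_sigma_algebraType G)).
have Gle u : <<s G >> [set w | u <= b w].
  rewrite (_ : [set _ | _] = b @^-1` `[u, +oo[); first exact: Gb.
  by apply/seteqP; split=> w /=; rewrite in_itv/= andbT.
rewrite (layer_cake P mb)//.
have -> : (c%:E * \int[P]_w (b w)%:E = \int[P]_w (b w * c)%:E)%E.
  have mbE : measurable_fun setT (fun w => (b w)%:E) by exact/measurable_EFinP.
  rewrite -(ge0_integralZl P measurableT mbE) ?lee_fin//; last first.
    by move=> w _; rewrite lee_fin; case/andP: (b01 w).
  by apply: eq_integral => w _; rewrite -EFinM mulrC.
rewrite (layer_cake P mb)//.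
apply: ge0_le_integral_lower => u _.
  by apply: integral_ge0 => w _; rewrite lee_fin.
by rewrite integral_cst; [exact: Xc|exact: mG].
Qed.

Lemma inv_weighted_sum_le (R : realType) (k : nat) (b x : 'I_k -> R) :
  (forall i, 0 <= b i) -> \sum_(i < k) b i = 1 -> (forall i, 0 < x i) ->
  0 < \sum_(i < k) b i * x i /\
  (\sum_(i < k) b i * x i)^-1 <= \sum_(i < k) b i / x i.
Proof.
move=> b0 b1 x0; set S := \sum_(i < k) b i * x i.
have S0 : 0 < S.
  rewrite lt_neqAle sumr_ge0 ?andbT => [|i _]; last first.
    by rewrite mulr_ge0// ltW.
  rewrite eq_sym psumr_neq0 => [|i _]; last by rewrite mulr_ge0// ltW.
  have /eqP := oner_neq0 R; rewrite -b1 => /eqP.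
  rewrite psumr_neq0// => /hasP[i ii bi]; apply/hasP; exists i => //=.
  by rewrite mulr_gt0.
split=> //.
(* The map taking x to 2 / S - x / S^2 is the tangent of 1 / x at [S]; its weighted mean is 1 / S,
   and it lies below 1 / x. *)
have -> : S^-1 = \sum_(i < k) b i * (2 / S - x i / S ^+ 2).
  under eq_bigr do rewrite mulrBr mulrA.
  rewrite sumrB -!mulr_suml b1 mul1r.
  under eq_bigr do rewrite mulrA.
  rewrite -mulr_suml -/S; field; exact: lt0r_neq0.
apply: ler_sum => i _; rewrite ler_wpM2l// -subr_ge0.
rewrite (_ : _ - _ = (S - x i) ^+ 2 / (x i * S ^+ 2)).
  by rewrite divr_ge0 ?sqr_ge0// mulr_ge0 ?sqr_ge0// ltW.
by field; rewrite !gt_eqF.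
Qed.

(** * Estimators and their mixtures *)

Section estimators.
Context d (T : measurableType d) (R : realType) (P : probability T R) (n : nat).
Variables (H : 'I_n -> {mfun T >-> bool}) (xi U : 'I_n -> {mfun T >-> R}).
Local Notation p := (pvalue H xi U).

Lemma ecdf_estimator_sigma lambda n0 :
  ecdf_estimator p lambda n0 -> sigma_measurable (ecdf_gen p lambda) n0.
Proof.
move=> [[g mg n0g] _] B mB.
rewrite (_ : n0 @^-1` B = (fun w t => ecdf p t w) @^-1` (g @^-1` B)); last first.
  by apply/seteqP; split=> w; rewrite /preimage/= n0g.
apply: (@sigma_preimage _ _ _ _ (evaluations lambda)); last exact: mg.
apply: gen_sub => t C tl mC; apply: sub_sigma_algebra.
by apply: (@gen_preimage _ _ _ _ _ (ecdf p)).
Qed.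

Lemma ecdf_gen_le s t : s <= t -> <<s ecdf_gen p t >> `<=` <<s ecdf_gen p s >>.
Proof.
move=> st; apply: sub_sigma_algebra2; apply: gen_sub => u B.
rewrite /= in_itv/= => /andP[tu u1] mB; apply: (@gen_preimage _ _ _ _ _ (ecdf p)) => //=.
by rewrite in_itv/= (le_trans st tu).
Qed.

Variable lambda : R.
Local Notation ratio n0 := (fun w => V p H lambda w / n0 w).

Lemma measurable_ratio (n0 : T -> R) : sigma_measurable (ecdf_gen p lambda) n0 ->
  (forall w, 0 < n0 w) -> measurable_fun setT (ratio n0).
Proof.
move=> mn0 n0_gt0; apply: measurable_funM; first exact: measurable_V.
exact: measurable_estimator_inv mn0 n0_gt0.
Qed.

(** Convexity is applied at each [w], so constant and random weights are covered alike. *)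
Lemma expectation_mixture_le k (b n0i : 'I_k -> T -> R) :
  (forall i, measurable_fun setT (b i)) ->
  (forall i w, 0 <= b i w) -> (forall w, \sum_(i < k) b i w = 1) ->
  (forall i, ecdf_estimator p lambda (n0i i)) ->
  ('E_P[ratio (fun w => \sum_(i < k) b i w * n0i i w)%R] <=
   \sum_(i < k) \int[P]_w (b i w * ratio (n0i i) w)%:E)%E.
Proof.
move=> mb b0 b1 en0.
have n0_gt0 i w : 0 < n0i i w by exact: (en0 i).2.
have mratio i : measurable_fun setT (ratio (n0i i)).
  by apply: measurable_ratio => //; exact: ecdf_estimator_sigma.
rewrite unlock -ge0_integral_sum//; last 2 first.
- by move=> i; apply/measurable_EFinP; exact: measurable_funM.
- by move=> i w _; rewrite lee_fin mulr_ge0// divr_ge0 ?V_ge0// ltW.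
apply: ge0_le_integral_lower => w _; rewrite ?sumEFin lee_fin;
  have [S0 Sle] := inv_weighted_sum_le (b0 ^~ w) (b1 w) (n0_gt0 ^~ w).
  by rewrite divr_ge0 ?V_ge0// ltW.
under [leRHS]eq_bigr do rewrite mulrCA.
by rewrite -mulr_sumr ler_wpM2l// V_ge0.
Qed.

End estimators.

Theorem theorem9 (d : measure_display) (T : measurableType d) (R : realType)
  (P : probability T R) (n : nat)
  (H : 'I_n -> {mfun T >-> bool}) (xi U : 'I_n -> {mfun T >-> R})
  (alpha lambda : R)
  (BI : BI_model P H xi U)
  (alpha_gt0 : 0 < alpha) (alpha_lt_lambda : alpha < lambda)
  (lambda_lt1 : lambda < 1) :
  let p := pvalue H xi U in
  let FDR := fun n0 : T -> R => FDR_SD p H P (adaptive_crit alpha lambda n0) in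
  let ratio := fun (n0 : T -> R) (w : T) => V p H lambda w / n0 w in
  (* (1) *)
  (forall n0 : T -> R, ecdf_estimator p lambda n0 ->
     (FDR n0 <= (alpha / lambda)%:E * 'E_P[ratio n0])%E) /\
  (* (2)(i) *)
  (forall lambda1 gamma1 : R,
     lambda <= lambda1 -> lambda1 < gamma1 -> gamma1 <= 1 ->
     let n0 := storey p lambda1 gamma1 in
     [/\ ('E_P[ratio n0] <= lambda%:E)%E,
         (FDR n0 <= alpha%:E)%E &
         cond_expectation_le P (ecdf_gen p gamma1) (ratio n0) lambda]) /\
  (* (2)(ii) *)
  (forall (k : nat) (beta : 'I_k -> R) (n0i : 'I_k -> T -> R),
     (forall i, 0 < beta i) -> \sum_(i < k) beta i = 1 ->
     (forall i, ecdf_estimator p lambda (n0i i)) ->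
     (forall i, ('E_P[ratio (n0i i)] <= lambda%:E)%E) ->
     let n0 := fun w => \sum_(i < k) beta i * n0i i w in
     ('E_P[ratio n0] <= lambda%:E)%E /\ (FDR n0 <= alpha%:E)%E) /\
  (* (2)(iii) *)
  (forall (k : nat) (gamma : 'I_k -> R) (beta : 'I_k -> T -> R),
     (forall i, lambda < gamma i <= 1) ->
     (forall i j : 'I_k, (i <= j)%N -> gamma i <= gamma j) ->
     (forall i w, 0 <= beta i w) ->
     (forall i, sigma_measurable (ecdf_gen p (gamma i)) (beta i)) ->
     (forall w, \sum_(i < k) beta i w = 1) ->
     (forall n0i : 'I_k -> T -> R,
        (forall i, ecdf_estimator p lambda (n0i i)) ->
        (forall i, cond_expectation_le P (ecdf_gen p (gamma i))
                     (ratio (n0i i)) lambda) ->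
        let n0 := fun w => \sum_(i < k) beta i w * n0i i w in
        ('E_P[ratio n0] <= lambda%:E)%E /\ (FDR n0 <= alpha%:E)%E) /\
     (* the generalized Storey estimators are admissible *)
     (forall (i : 'I_k) (lambda_i : R),
        lambda <= lambda_i -> lambda_i < gamma i ->
        ecdf_estimator p lambda (storey p lambda_i (gamma i)) /\
        cond_expectation_le P (ecdf_gen p (gamma i))
          (ratio (storey p lambda_i (gamma i))) lambda)).
Proof.
move=> p FDR ratio.
have lambda_gt0 : 0 < lambda by exact: lt_trans alpha_lt_lambda.
(* Stated for [sigma_measurable] rather than [ecdf_estimator], so that it applies to mixtures
   without exhibiting a functional of the empirical distribution function. *)
have FDR_le (n0 : T -> R) :
    sigma_measurable (ecdf_gen p lambda) n0 -> (forall w, 0 < n0 w) ->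
    (FDR n0 <= (alpha / lambda)%:E * 'E_P[ratio n0])%E.
  by move=> mn0 n0_gt0; apply: FDR_SD_le => //; exact: ltW.
have FDR_control (n0 : T -> R) : sigma_measurable (ecdf_gen p lambda) n0 ->
    (forall w, 0 < n0 w) -> ('E_P[ratio n0] <= lambda%:E)%E -> (FDR n0 <= alpha%:E)%E.
  move=> mn0 n0_gt0 En0; apply: le_trans (FDR_le n0 mn0 n0_gt0) _.
  have -> : (alpha%:E = (alpha / lambda)%:E * lambda%:E)%E.
    by rewrite -EFinM divfK// gt_eqF.
  by rewrite lee_wpmul2l// lee_fin divr_ge0// ltW.
have storeyP lambda1 gamma1 : lambda <= lambda1 -> lambda1 < gamma1 -> gamma1 <= 1 ->
    ecdf_estimator p lambda (storey p lambda1 gamma1) /\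
    cond_expectation_le P (ecdf_gen p gamma1) (ratio (storey p lambda1 gamma1)) lambda.
  move=> l1 g1 g2; have en0 := storey_estimator BI l1 g1 g2.
  split=> //; apply: cond_expectation_leI.
  - exact: ecdf_gen_measurable.
  - apply: measurable_ratio; first exact: ecdf_estimator_sigma.
    exact: en0.2.
  - by move=> w; rewrite divr_ge0 ?V_ge0// ltW//; exact: en0.2.
  - by move=> A; exact: integral_storey_le.
split; [|split; [|split]].
- by move=> n0 en0; apply: FDR_le; [exact: ecdf_estimator_sigma|exact: en0.2].
- move=> lambda1 gamma1 l1 g1 g2 n0.
  have [en0 cn0] := storeyP _ _ l1 g1 g2.
  have En0 : ('E_P[ratio n0] <= lambda%:E)%E.
    (* The unconditional bound is the case [A = setT]. *)
    rewrite unlock -[lambda%:E]mule1 -(@probability_setT _ _ _ P).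
    apply: (integral_storey_le BI lambda_gt0 l1 g1 g2).
    exact: (@measurableT _ (g_sigma_algebraType _)).
  split=> //; apply: FDR_control => //; first exact: ecdf_estimator_sigma.
  exact: en0.2.
- move=> k beta n0i b_gt0 b1 en0 En0 n0.
  have b_ge0 i : 0 <= beta i by exact: ltW.
  have n0_gt0 w : 0 < n0 w.
    by have [] := inv_weighted_sum_le b_ge0 b1 (fun i => (en0 i).2 w).
  have mn0 : sigma_measurable (ecdf_gen p lambda) n0.
    apply/sigma_measurableE; apply: measurable_sum => i; apply: measurable_funM => //.
    by apply/sigma_measurableE; exact: ecdf_estimator_sigma (en0 i).
  suff E : ('E_P[ratio n0] <= lambda%:E)%E by split=> //; exact: FDR_control.
  apply: (le_trans (expectation_mixture_le P (b := fun i _ => beta i) _ _ _ en0)) => //.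
  rewrite [leRHS](_ : _ = (\sum_(i < k) (beta i * lambda)%:E)%E); last first.
    by rewrite sumEFin -mulr_suml b1 mul1r.
  apply: lee_sum => i _.
  under eq_integral do rewrite EFinM.
  rewrite ge0_integralZl ?lee_fin//; last 2 first.
  + apply/measurable_EFinP; apply: (measurable_ratio (n0 := n0i i)).
      exact: ecdf_estimator_sigma (en0 i).
    exact: (en0 i).2.
  + by move=> w _; rewrite lee_fin divr_ge0 ?V_ge0// ltW//; exact: (en0 i).2.
  by rewrite EFinM lee_wpmul2l ?lee_fin//; have := En0 i; rewrite unlock.
- move=> k gamma beta gl _ b_ge0 mb b1; split; last first.
    by move=> i l l1 lg; apply: storeyP => //; case/andP: (gl i).
  move=> n0i en0 cn0 n0.
  have n0_gt0 w : 0 < n0 w.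
    by have [] := inv_weighted_sum_le (b_ge0 ^~ w) (b1 w) (fun i => (en0 i).2 w).
  (* Nonnegative weights with sum 1 are at most 1, as [le_integral_weight] requires. *)
  have b01 i w : 0 <= beta i w <= 1.
    by rewrite b_ge0 -(b1 w) (bigD1 i)//= lerDl sumr_ge0.
  have mn0 : sigma_measurable (ecdf_gen p lambda) n0.
    apply/sigma_measurableE; apply: measurable_sum => i; apply: measurable_funM.
      apply/sigma_measurableE => B mB; apply: (@ecdf_gen_le _ _ _ _ _ _ _ _ (gamma i)).
        by case/andP: (gl i) => /ltW.
      exact: mb.
    by apply/sigma_measurableE; exact: ecdf_estimator_sigma (en0 i).
  have mbT i : measurable_fun setT (beta i).
    apply: (measurable_sub_sigma (@ecdf_gen_measurable _ _ _ _ H xi U (gamma i))).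
      exact: (@measurableT _ (g_sigma_algebraType _)).
    by apply/sigma_measurableE; exact: mb.
  suff E : ('E_P[ratio n0] <= lambda%:E)%E by split=> //; exact: FDR_control.
  apply: (le_trans (expectation_mixture_le P mbT b_ge0 b1 en0)).
  (* Each weight is measurable for the sigma-algebra of its own conditional bound, so it can be put
     inside that bound; the expected weights then add up to 1. *)
  apply: (@le_trans _ _ (\sum_(i < k) lambda%:E * \int[P]_w (beta i w)%:E)%E).
    apply: lee_sum => i _.
    have mr : measurable_fun setT (ratio (n0i i)).
      apply: (measurable_ratio (n0 := n0i i)); first exact: ecdf_estimator_sigma (en0 i).
      exact: (en0 i).2.
    have r0 w : 0 <= ratio (n0i i) w by rewrite divr_ge0 ?V_ge0// ltW//; exact: (en0 i).2.
    apply: (@le_integral_weight _ _ _ _ (ecdf_gen p (gamma i))) => //.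
    - exact: ecdf_gen_measurable.
    - exact: ltW.
    - move=> A; apply: cond_expectation_le_integral => //.
      + exact: ecdf_gen_measurable.
      + exact: ltW.
      + exact: cn0.
  rewrite -ge0_sume_distrr => [|i _]; last first.
    by apply: integral_ge0 => w _; rewrite lee_fin.
  rewrite -ge0_integral_sum//; last 2 first.
  + by move=> i; exact/measurable_EFinP.
  + by move=> i w _; rewrite lee_fin.
  under eq_integral do rewrite sumEFin b1.
  by rewrite integral_cst// mul1e [X in (_ * X)%E](@probability_setT _ _ _ P) mule1.
Qed.
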